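(* Let $p,q$ be non-negative integers. Let $\bar p\in\{0,1\}$ be the residue of $p$ modulo $2$. Then the complex Clifford superalgebra $\mathbb{C}_{p,q}$ is graded Morita equivalent to $\mathbb{C}_{\bar p,q}$, and $\mathbb{C}_{\bar p,q}$ is a graded basic superalgebra.
   Context: Superalgebras. A superalgebra over a field $K$ (here $K=\mathbb{C}$) is a $\mathbb{Z}_2$-graded unital associative $K$-algebra $A=A_0\oplus A_1$ with $A_iA_j\subseteq A_{i+j}$. Homomorphisms (hence isomorphisms $\cong$) of superalgebras are even (degree-preserving) algebra homomorphisms. Modules. ''$A$-module'' means $\mathbb{Z}_2$-graded left $A$-module. $\mathrm{Gr}\,A$ is the category of $A$-modules with even (degree-preserving) $A$-linear maps. The functors $\pi,\sigma:\mathrm{Gr}\,A\to\mathrm{Gr}\,A$ are: $\pi(M)_i=\sigma(M)_i=M_{i+1}$, with actions $a\,\pi(m)=(-1)^{|a|}\pi(am)$ and $a\,\sigma(m)=\sigma(am)$ for homogeneous $a,m$; on morphisms both keep the same underlying linear map. Let $S\in\{\pi,\sigma\}$. For $A$-modules $M,N$ put $\mathrm{Hom}^S_A(M,N)=\mathrm{Hom}_{\mathrm{Gr}A}(M,N)\oplus\mathrm{Hom}_{\mathrm{Gr}A}(S(M),N)$ (summands in degrees $0$ and $1$). $\mathrm{Mod}^S A$ is the category of all $A$-modules with morphism spaces $\mathrm{Hom}_A^S(M,N)$, composed via the underlying linear maps. $\mathrm{End}^S_A(M)=\mathrm{Hom}^S_A(M,M)$ is a superalgebra whose multiplication is composition of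 underlying linear maps, with maps written on the right, so that $\mathrm{End}^\sigma_A(Af)=fAf$ for a degree-zero idempotent $f$. Equivalence. Finite dimensional superalgebras $A,B$ over $K$ are graded Morita equivalent (that is, $\sigma$-graded equivalent) if the categories $\mathrm{Gr}\,A$ and $\mathrm{Gr}\,B$ are equivalent and $B\cong\mathrm{End}^\sigma_A(P)$ for some finitely generated projective $A$-module $P$. Graded basic. $A$ is $S$-graded basic if, for a complete set $f_1,\dots,f_n$ of primitive orthogonal (degree-zero) idempotents, the modules $Af_i$ and $Af_j$ are not isomorphic in $\mathrm{Mod}^S A$ for $i\ne j$. $A$ is graded basic if it is $\sigma$-graded basic or $\pi$-graded basic. Clifford superalgebras. $\mathbb{C}_{p,q}$ is the complex unital superalgebra generated by odd generators $e_1,\dots,e_{p+q}$ with relations $e_ie_j+e_je_i=0$ for $i\neq j$, $e_i^2=1$ for $1\le i\le p$, and $e_{p+j}^2=0$ for $1\le j\le q$. *)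

(* Defs.v *)
From HB Require Import structures.
From mathcomp Require Import all_boot all_order all_algebra.
From mathcomp Require Import boolp reals complex.

Set Implicit Arguments.
Unset Strict Implicit.
Unset Printing Implicit Defensive.

Import Order.TTheory GRing.Theory Num.Theory.
Local Open Scope ring_scope.
Local Open Scope quotient_scope.

(* The degree group Z_2 is [bool], with [addb] (written [(+)]) as addition:
   [false] is the degree 0 and [true] is the degree 1. *)
Record is_grading (V : zmodType) (V_ : bool -> V -> Prop) : Prop := IsGrading {
  gr0 : forall i, V_ i 0;
  grB : forall i x y, V_ i x -> V_ i y -> V_ i (x - y);
  grD : forall x, exists x0 x1, [/\ V_ false x0, V_ true x1 & x = x0 + x1];
  grI : forall x, V_ false x -> V_ true x -> x = 0 }.

(* The K-algebra structure is a unital ring morphism from K to the center of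
   the ring.  The library's [algType K] is not used because it excludes the zero
   ring, which occurs as the endomorphism ring of the zero module. *)
Record superalgebra (K : fieldType) := Superalgebra {
  sa_ring :> pzRingType;
  sa_in : {rmorphism K -> sa_ring};
  sa_central : forall k a, sa_in k * a = a * sa_in k;
  sa_comp : bool -> sa_ring -> Prop;
  sa_grading : is_grading sa_comp;
  sa_compZ : forall i k a, sa_comp i a -> sa_comp i (sa_in k * a);
  sa_compM : forall i j a b,
    sa_comp i a -> sa_comp j b -> sa_comp (i (+) j) (a * b) }.

Definition superalgebra_iso (K : fieldType) (A B : superalgebra K) : Prop :=
  exists phi : {rmorphism A -> B},
    [/\ bijective phi,
        forall k, phi (sa_in A k) = sa_in B k
      & forall i a, sa_comp i a -> sa_comp i (phi a)].

Definition finite_dimensional (K : fieldType) (A : superalgebra K) : Prop :=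
  exists s : seq A, forall a : A, exists c : 'I_(size s) -> K,
    a = \sum_(i < size s) sa_in A (c i) * s`_i.

Section GradingTheory.
Variables (V : zmodType) (V_ : bool -> V -> Prop) (grV : is_grading V_).

Lemma grN i x : V_ i x -> V_ i (- x).
Proof. by move=> h; rewrite -sub0r; apply: (grB grV) => //; apply: gr0 grV i. Qed.

Lemma grA i x y : V_ i x -> V_ i y -> V_ i (x + y).
Proof. by move=> hx hy; rewrite -[y]opprK; apply: (grB grV) => //; apply: grN. Qed.

Lemma gr_uniq x0 x1 y0 y1 : V_ false x0 -> V_ true x1 -> V_ false y0 ->
  V_ true y1 -> x0 + x1 = y0 + y1 -> x0 = y0 /\ x1 = y1.
Proof.
move=> hx0 hx1 hy0 hy1 e.
have e' : x0 - y0 = y1 - x1.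
  by apply/eqP; rewrite subr_eq addrAC eq_sym subr_eq e addrC.
have z : x0 - y0 = 0.
  by apply: (grI grV); [exact: (grB grV) | rewrite e'; exact: (grB grV)].
split; first by apply/eqP; rewrite -subr_eq0 z.
by apply/esym/eqP; rewrite -subr_eq0 -e' z.
Qed.

Lemma gr_parts x : {y : V * V | [/\ V_ false y.1, V_ true y.2 & x = y.1 + y.2]}.
Proof. by apply: cid; have [x0 [x1 h]] := grD grV x; exists (x0, x1). Qed.

End GradingTheory.

Section Parity.
Variables (K : fieldType) (A : superalgebra K).
Local Notation grA_ := (sa_grading A).

Lemma sa_comp1 : sa_comp false (1 : A).
Proof.
have [u [v [hu hv e]]] := grD grA_ 1.
have av i (a : A) : sa_comp i a -> a * v = 0.
  move=> ha; have /= h1 := sa_compM ha hv; have h0 := sa_compM ha hu.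
  have e' : a - a * u = a * v by rewrite -[X in X - _]mulr1 e mulrDr addrC addKr.
  have h2 : sa_comp i (a * v).
    by rewrite -e'; apply: (grB grA_) => //; move: h0; rewrite addbF.
  by case: i {ha h0} h1 h2 => /= h1 h2; apply: (grI grA_).
have v0 : v = 0.
  have [x0 [x1 [h0 h1 e1]]] := grD grA_ 1.
  by rewrite -[v]mul1r e1 mulrDl (av _ _ h0) (av _ _ h1) addr0.
by rewrite e v0 addr0.
Qed.

Lemma sa_comp_in k : sa_comp false (sa_in A k).
Proof. by rewrite -[sa_in A k]mulr1; apply/sa_compZ/sa_comp1. Qed.

(* a |-> (-1)^|a| a on homogeneous elements; it twists the action on pi(M). *)
Definition parity (a : A) : A :=
  let y := sval (gr_parts grA_ a) in y.1 - y.2.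

Lemma parityE a0 a1 : sa_comp false a0 -> sa_comp true a1 ->
  parity (a0 + a1) = a0 - a1.
Proof.
rewrite /parity; case: gr_parts => -[b0 b1] /= [hb0 hb1 e] h0 h1.
by have [-> ->] := gr_uniq grA_ h0 h1 hb0 hb1 e.
Qed.

Lemma parity0 a : sa_comp false a -> parity a = a.
Proof.
by move=> h; rewrite -{1}[a]addr0 parityE ?subr0 //; apply: (gr0 grA_).
Qed.

Lemma parity1 a : sa_comp true a -> parity a = - a.
Proof.
by move=> h; rewrite -{1}[a]add0r parityE ?sub0r //; apply: (gr0 grA_).
Qed.

Lemma parity_comp i a : sa_comp i a -> sa_comp i (parity a).
Proof.
by case: i => h; [rewrite parity1 //; apply: (grN grA_)|rewrite parity0].
Qed.

Lemma parityD a b : parity (a + b) = parity a + parity b.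
Proof.
have [a0 [a1 [ha0 ha1 ->]]] := grD grA_ a.
have [b0 [b1 [hb0 hb1 ->]]] := grD grA_ b.
rewrite addrACA (parityE ha0 ha1) (parityE hb0 hb1).
rewrite parityE; [by rewrite opprD addrACA | exact: (grA grA_)..].
Qed.

Lemma parityM a b : parity (a * b) = parity a * parity b.
Proof.
have [a0 [a1 [ha0 ha1 ->]]] := grD grA_ a.
have [b0 [b1 [hb0 hb1 ->]]] := grD grA_ b.
have h00 := sa_compM ha0 hb0; have h01 := sa_compM ha0 hb1.
have h10 := sa_compM ha1 hb0; have h11 := sa_compM ha1 hb1.
rewrite (parityE ha0 ha1) (parityE hb0 hb1) !mulrDl !mulrDr !parityD.
rewrite (parity0 h00) (parity1 h01) (parity1 h10) (parity0 h11).
by rewrite !mulrN !mulNr opprK.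
Qed.

Lemma parityK a : parity (parity a) = a.
Proof.
have [a0 [a1 [ha0 ha1 ->]]] := grD grA_ a.
by rewrite (parityE ha0 ha1) (parityE ha0 (grN grA_ ha1)) opprK.
Qed.

End Parity.

Record grmod (K : fieldType) (A : superalgebra K) := GrMod {
  gm_mod :> lmodType A;
  gm_comp : bool -> gm_mod -> Prop;
  gm_grading : is_grading gm_comp;
  gm_compZ : forall i j (a : A) (m : gm_mod),
    sa_comp i a -> gm_comp j m -> gm_comp (i (+) j) (a *: m) }.

Record is_gr_hom (K : fieldType) (A : superalgebra K) (M N : grmod A)
    (f : M -> N) : Prop := IsGrHom {
  grhD : forall x y, f (x + y) = f x + f y;
  grhZ : forall (a : A) x, f (a *: x) = a *: f x;
  grh_comp : forall i x, gm_comp i x -> gm_comp i (f x) }.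

Record gr_hom (K : fieldType) (A : superalgebra K) (M N : grmod A) := GrHom {
  gr_fun :> M -> N;
  gr_homP : is_gr_hom gr_fun }.

Variant shift := Pi | Sigma.

Section Shift.
Variables (K : fieldType) (A : superalgebra K) (S : shift).

Definition twist (a : A) : A := if S is Pi then parity a else a.

Lemma twist1 : twist 1 = 1.
Proof. by rewrite /twist; case: S => //; apply/parity0/sa_comp1. Qed.

Lemma twistD a b : twist (a + b) = twist a + twist b.
Proof. by rewrite /twist; case: S => //; apply: parityD. Qed.

Lemma twistM a b : twist (a * b) = twist a * twist b.
Proof. by rewrite /twist; case: S => //; apply: parityM. Qed.

Lemma twistK a : twist (twist a) = a.
Proof. by rewrite /twist; case: S => //; apply: parityK. Qed.

Lemma twist_comp i a : sa_comp i a -> sa_comp i (twist a).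
Proof. by rewrite /twist; case: S => //; apply: parity_comp. Qed.

Definition shift_sort (M : lmodType A) : Type := M.
HB.instance Definition _ (M : lmodType A) := GRing.Zmodule.on (shift_sort M).

(* pi twists the action by (-1)^|a|; sigma keeps it unchanged. *)
Definition shift_scale (M : lmodType A) (a : A) (m : shift_sort M) :
  shift_sort M := twist a *: (m : M).

Fact shift_scaleA (M : lmodType A) a b (m : shift_sort M) :
  shift_scale a (shift_scale b m) = shift_scale (a * b) m.
Proof. by rewrite /shift_scale scalerA twistM. Qed.
Fact shift_scale1 (M : lmodType A) : left_id 1 (@shift_scale M).
Proof. by move=> m; rewrite /shift_scale twist1 scale1r. Qed.
Fact shift_scaleDr (M : lmodType A) : right_distributive (@shift_scale M) +%R.
Proof. by move=> a m n; rewrite /shift_scale scalerDr. Qed.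
Fact shift_scaleDl (M : lmodType A) (m : shift_sort M) :
  {morph (@shift_scale M)^~ m : a b / a + b}.
Proof. by move=> a b; rewrite /shift_scale twistD scalerDl. Qed.

HB.instance Definition _ (M : lmodType A) :=
  GRing.Zmodule_isLmodule.Build A (shift_sort M) (@shift_scaleA M)
    (@shift_scale1 M) (@shift_scaleDr M) (@shift_scaleDl M).

Definition shift_comp (M : grmod A) (i : bool) (m : shift_sort M) : Prop :=
  gm_comp (i (+) true) (m : M).

Fact shift_grading (M : grmod A) : is_grading (@shift_comp M).
Proof.
have g := gm_grading M; split.
- by move=> i; apply: (gr0 g).
- by move=> i x y; apply: (grB g).
- move=> x; have [x0 [x1 [h0 h1 e]]] := grD g x.
  by exists x1, x0; split=> //; rewrite [LHS]e addrC.
- by move=> x h0 h1; apply: (grI g).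
Qed.

Fact shift_compZ (M : grmod A) i j (a : A) (m : shift_sort M) :
  sa_comp i a -> shift_comp j m -> shift_comp (i (+) j) (a *: m).
Proof.
by move=> ha hm; rewrite /shift_comp -addbA; apply: gm_compZ => //;
  apply: twist_comp.
Qed.

(* [shift_mod] is the functor S on objects; on morphisms S keeps the underlying
   map. *)
Definition shift_mod (M : grmod A) : grmod A :=
  @GrMod K A (shift_sort M) (@shift_comp M) (shift_grading M) (@shift_compZ M).

Lemma shift_hom_subproof (M N : grmod A) (f : M -> N) : is_gr_hom f ->
  @is_gr_hom K A (shift_mod M) (shift_mod N) f.
Proof.
case=> hD hZ hc; split=> [x y|a x|i x]; [exact: hD|exact: hZ|exact: hc].
Qed.

Lemma shift2_hom_subproof (M N : grmod A) (f : M -> N) :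
  @is_gr_hom K A (shift_mod (shift_mod M)) N f -> is_gr_hom f.
Proof.
case=> hD hZ hc; split=> [x y|a x|i x hx].
- exact: hD.
- rewrite -hZ; congr (f _).
  by rewrite {2}/GRing.scale /= /shift_scale /GRing.scale /= /shift_scale twistK.
- by apply: hc; rewrite /= /shift_comp /= /shift_comp addbK.
Qed.

End Shift.

Record category := Category {
  cat_obj :> Type;
  cat_hom : cat_obj -> cat_obj -> Type;
  cat_id : forall X, cat_hom X X;
  cat_comp : forall X Y Z, cat_hom X Y -> cat_hom Y Z -> cat_hom X Z;
  cat_idl : forall X Y (f : cat_hom X Y), cat_comp (cat_id X) f = f;
  cat_idr : forall X Y (f : cat_hom X Y), cat_comp f (cat_id Y) = f;
  cat_assoc : forall X Y Z T (f : cat_hom X Y) (g : cat_hom Y Z)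
    (h : cat_hom Z T), cat_comp f (cat_comp g h) = cat_comp (cat_comp f g) h }.

(* Composition is in diagrammatic order: [cat_comp f g] is f followed by g. *)
Arguments cat_id {c} X.
Arguments cat_comp {c X Y Z} f g.

Definition cat_isomorphic (C : category) (X Y : C) : Prop :=
  exists (f : cat_hom X Y) (g : cat_hom Y X),
    cat_comp f g = cat_id X /\ cat_comp g f = cat_id Y.

Record functor (C D : category) := Functor {
  fun_obj :> C -> D;
  fun_map : forall X Y : C, cat_hom X Y -> cat_hom (fun_obj X) (fun_obj Y);
  fun_id : forall X : C, fun_map (cat_id X) = cat_id (fun_obj X);
  fun_comp : forall (X Y Z : C) (f : cat_hom X Y) (g : cat_hom Y Z),
    fun_map (cat_comp f g) = cat_comp (fun_map f) (fun_map g) }.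
Arguments fun_map {C D} F {X Y} f : rename.

Definition id_functor (C : category) : functor C C :=
  @Functor C C id (fun _ _ => id) (fun=> erefl) (fun _ _ _ _ _ => erefl).

Fact comp_functor_id (C D E : category) (F : functor C D) (G : functor D E)
  (X : C) : fun_map G (fun_map F (cat_id X)) = cat_id (G (F X)).
Proof. by rewrite !fun_id. Qed.
Fact comp_functor_comp (C D E : category) (F : functor C D) (G : functor D E)
  (X Y Z : C) (f : cat_hom X Y) (g : cat_hom Y Z) :
  fun_map G (fun_map F (cat_comp f g)) =
  cat_comp (fun_map G (fun_map F f)) (fun_map G (fun_map F g)).
Proof. by rewrite !fun_comp. Qed.

Definition comp_functor (C D E : category) (F : functor C D) (G : functor D E) :
  functor C E :=
  @Functor C E (fun X => G (F X)) (fun _ _ f => fun_map G (fun_map F f))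
    (comp_functor_id F G) (comp_functor_comp F G).

Definition naturally_isomorphic (C D : category) (F G : functor C D) : Prop :=
  exists (eta : forall X : C, cat_hom (F X) (G X))
         (eps : forall X : C, cat_hom (G X) (F X)),
    [/\ forall X, cat_comp (eta X) (eps X) = cat_id (F X),
        forall X, cat_comp (eps X) (eta X) = cat_id (G X)
      & forall (X Y : C) (f : cat_hom X Y),
          cat_comp (fun_map F f) (eta Y) = cat_comp (eta X) (fun_map G f)].

Definition equivalent_categories (C D : category) : Prop :=
  exists (F : functor C D) (G : functor D C),
    naturally_isomorphic (comp_functor F G) (id_functor C) /\
    naturally_isomorphic (comp_functor G F) (id_functor D).

Section GrHom.
Variables (K : fieldType) (A : superalgebra K).
Implicit Types M N L : grmod A.

Lemma gr_hom_eq M N (f g : gr_hom M N) : (forall x, f x = g x) -> f = g.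
Proof.
case: f g => f hf [g hg] /= /funext e; case: g / e in hg *.
by congr GrHom; apply: Prop_irrelevance.
Qed.

Fact id_hom_subproof M : is_gr_hom (@id M).
Proof. by split. Qed.
Definition id_hom M : gr_hom M M := GrHom (id_hom_subproof M).

Fact comp_hom_subproof M N L (f : M -> N) (g : N -> L) :
  is_gr_hom f -> is_gr_hom g -> is_gr_hom (g \o f).
Proof.
move=> hf hg; split=> [x y|a x|i x hx] /=.
- by rewrite (grhD hf) (grhD hg).
- by rewrite (grhZ hf) (grhZ hg).
- exact/(grh_comp hg)/(grh_comp hf).
Qed.
Definition comp_hom M N L (f : gr_hom M N) (g : gr_hom N L) : gr_hom M L :=
  GrHom (comp_hom_subproof (gr_homP f) (gr_homP g)).

Fact zero_hom_subproof M N : is_gr_hom (fun _ : M => 0 : N).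
Proof.
split=> [x y|a x|i x _]; rewrite ?addr0 ?scaler0 //.
exact: (gr0 (gm_grading N)).
Qed.
Definition zero_hom M N : gr_hom M N := GrHom (zero_hom_subproof M N).

Fact opp_hom_subproof M N (f : gr_hom M N) : is_gr_hom (fun x => - f x).
Proof.
have hf := gr_homP f; split=> [x y|a x|i x hx].
- by rewrite (grhD hf) opprD.
- by rewrite (grhZ hf) scalerN.
- exact/(grN (gm_grading N))/(grh_comp hf).
Qed.
Definition opp_hom M N (f : gr_hom M N) : gr_hom M N :=
  GrHom (opp_hom_subproof f).

Fact add_hom_subproof M N (f g : gr_hom M N) : is_gr_hom (fun x => f x + g x).
Proof.
have [hf hg] := (gr_homP f, gr_homP g); split=> [x y|a x|i x hx].
- by rewrite (grhD hf) (grhD hg) addrACA.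
- by rewrite (grhZ hf) (grhZ hg) scalerDr.
- by apply: (grA (gm_grading N)); [apply: (grh_comp hf)|apply: (grh_comp hg)].
Qed.
Definition add_hom M N (f g : gr_hom M N) : gr_hom M N :=
  GrHom (add_hom_subproof f g).

HB.instance Definition _ M N := gen_eqMixin (gr_hom M N).
HB.instance Definition _ M N := gen_choiceMixin (gr_hom M N).

Fact add_homA M N : associative (@add_hom M N).
Proof. by move=> f g h; apply: gr_hom_eq => x /=; rewrite addrA. Qed.
Fact add_homC M N : commutative (@add_hom M N).
Proof. by move=> f g; apply: gr_hom_eq => x /=; rewrite addrC. Qed.
Fact add_hom0 M N : left_id (zero_hom M N) (@add_hom M N).
Proof. by move=> f; apply: gr_hom_eq => x /=; rewrite add0r. Qed.
Fact add_homN M N : left_inverse (zero_hom M N) (@opp_hom M N) (@add_hom M N).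
Proof. by move=> f; apply: gr_hom_eq => x /=; rewrite addNr. Qed.

HB.instance Definition _ M N := GRing.isZmodule.Build (gr_hom M N)
  (@add_homA M N) (@add_homC M N) (@add_hom0 M N) (@add_homN M N).

Fact scale_hom_subproof M N (k : K) (f : gr_hom M N) :
  is_gr_hom (fun x => sa_in A k *: f x).
Proof.
have hf := gr_homP f; split=> [x y|a x|i x hx].
- by rewrite (grhD hf) scalerDr.
- by rewrite (grhZ hf) !scalerA sa_central.
- by apply: (gm_compZ (i := false)); [apply: sa_comp_in|apply: (grh_comp hf)].
Qed.
Definition scale_hom M N (k : K) (f : gr_hom M N) : gr_hom M N :=
  GrHom (scale_hom_subproof k f).

Fact comp_hom_idl M N (f : gr_hom M N) : comp_hom (id_hom M) f = f.
Proof. exact: gr_hom_eq. Qed.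
Fact comp_hom_idr M N (f : gr_hom M N) : comp_hom f (id_hom N) = f.
Proof. exact: gr_hom_eq. Qed.
Fact comp_homA M N L P (f : gr_hom M N) (g : gr_hom N L) (h : gr_hom L P) :
  comp_hom f (comp_hom g h) = comp_hom (comp_hom f g) h.
Proof. exact: gr_hom_eq. Qed.

End GrHom.

Definition Gr (K : fieldType) (A : superalgebra K) : category :=
  @Category (grmod A) (@gr_hom K A) (@id_hom K A) (@comp_hom K A)
    (@comp_hom_idl K A) (@comp_hom_idr K A) (@comp_homA K A).

Section ModS.
Variables (K : fieldType) (A : superalgebra K) (S : shift).
Implicit Types M N L : grmod A.
Local Notation sh := (shift_mod S).

(* Hom^S_A(M, N) is the direct sum of Hom(M, N) and Hom(S M, N); the underlying
   map M -> N of the pair (f0, f1) is f0 + f1. *)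
Record homS M N := HomS { hS0 : gr_hom M N; hS1 : gr_hom (sh M) N }.

Definition underlying M N (f : homS M N) (x : M) : N := hS0 f x + hS1 f x.

Lemma homS_eq M N (f g : homS M N) : (forall x, hS0 f x = hS0 g x) ->
  (forall x, hS1 f x = hS1 g x) -> f = g.
Proof.
case: f g => f0 f1 [g0 g1] /= e0 e1.
by rewrite (gr_hom_eq e0) (@gr_hom_eq K A (sh M) N f1 g1 e1).
Qed.

Definition shift_map M N (f : gr_hom M N) : gr_hom (sh M) (sh N) :=
  GrHom (shift_hom_subproof S (gr_homP f)).

Definition unshift2 M N (f : gr_hom (sh (sh M)) N) : gr_hom M N :=
  GrHom (shift2_hom_subproof (gr_homP f)).

Definition idS M : homS M M := HomS (id_hom M) 0.

Definition compS M N L (f : homS M N) (g : homS N L) : homS M L :=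
  HomS (comp_hom (hS0 f) (hS0 g) + unshift2 (comp_hom (shift_map (hS1 f)) (hS1 g)))
       (comp_hom (shift_map (hS0 f)) (hS1 g) + comp_hom (hS1 f) (hS0 g)).

Lemma underlying_comp M N L (f : homS M N) (g : homS N L) x :
  underlying (compS f g) x = underlying g (underlying f x).
Proof.
rewrite /underlying /= (grhD (gr_homP (hS0 g))) (grhD (gr_homP (hS1 g))).
by rewrite addrACA [X in _ + X]addrC addrACA.
Qed.

Lemma underlying_inj M N (f g : homS M N) :
  (forall x, underlying f x = underlying g x) -> f = g.
Proof.
move=> e; have gN := gm_grading N.
have key i x : gm_comp i x -> hS0 f x = hS0 g x /\ hS1 f x = hS1 g x.
  move=> hx; have := e x; rewrite /underlying.
  have c0 (h : homS M N) : gm_comp i (hS0 h x).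
    exact: (grh_comp (gr_homP (hS0 h))).
  have c1 (h : homS M N) : gm_comp (i (+) true) (hS1 h x).
    by apply: (grh_comp (gr_homP (hS1 h))); rewrite /= /shift_comp addbK.
  have := (c0 f, c0 g, c1 f, c1 g).
  case: i {hx c0 c1} => /= -[[[f0 g0] f1] g1] e'.
    by rewrite addrC [RHS]addrC in e'; have [] := gr_uniq gN f1 f0 g1 g0 e'.
  exact: (gr_uniq gN f0 f1 g0 g1 e').
apply: homS_eq => x; have [x0 [x1 [h0 h1 ->]]] := grD (gm_grading M) x.
  by rewrite !(grhD (gr_homP (hS0 _))) (key _ _ h0).1 (key _ _ h1).1.
rewrite (grhD (gr_homP (hS1 f)) x0 x1) (grhD (gr_homP (hS1 g)) x0 x1).
by rewrite (key _ _ h0).2 (key _ _ h1).2.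
Qed.

Lemma underlying_id M x : underlying (idS M) x = x.
Proof. exact: addr0. Qed.

Fact compS_idl M N (f : homS M N) : compS (idS M) f = f.
Proof. by apply: underlying_inj => x; rewrite underlying_comp underlying_id. Qed.
Fact compS_idr M N (f : homS M N) : compS f (idS N) = f.
Proof. by apply: underlying_inj => x; rewrite underlying_comp underlying_id. Qed.
Fact compSA M N L P (f : homS M N) (g : homS N L) (h : homS L P) :
  compS f (compS g h) = compS (compS f g) h.
Proof. by apply: underlying_inj => x; rewrite !underlying_comp. Qed.

Definition ModS : category :=
  @Category (grmod A) homS idS compS compS_idl compS_idr compSA.

Definition endS M : Type := homS M M.

Section End.
Variable M : grmod A.
Implicit Types f g h : endS M.

Definition endS_zero : endS M := HomS 0 0.
Definition endS_opp f : endS M := HomS (- hS0 f) (- hS1 f).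
Definition endS_add f g : endS M := HomS (hS0 f + hS0 g) (hS1 f + hS1 g).
(* As maps are written on the right, f * g is f followed by g. *)
Definition endS_mul f g : endS M := compS f g.
Definition endS_in (k : K) : endS M := HomS (scale_hom k (id_hom M)) 0.
Definition endS_comp (i : bool) f : Prop := if i then hS0 f = 0 else hS1 f = 0.

HB.instance Definition _ := gen_eqMixin (endS M).
HB.instance Definition _ := gen_choiceMixin (endS M).

Fact endS_addA : associative endS_add.
Proof. by move=> f g h; rewrite /endS_add /= !addrA. Qed.
Fact endS_addC : commutative endS_add.
Proof. by move=> f g; congr HomS; apply: addrC. Qed.
Fact endS_add0 : left_id endS_zero endS_add.
Proof. by case=> f0 f1; congr HomS; apply: add0r. Qed.
Fact endS_addN : left_inverse endS_zero endS_opp endS_add.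
Proof. by case=> f0 f1; congr HomS; apply: addNr. Qed.

HB.instance Definition _ := GRing.isZmodule.Build (endS M)
  endS_addA endS_addC endS_add0 endS_addN.

Lemma underlyingD (f g : endS M) x :
  underlying (f + g) x = underlying f x + underlying g x.
Proof. exact: addrACA. Qed.

Lemma underlying_add (f : endS M) x y :
  underlying f (x + y) = underlying f x + underlying f y.
Proof.
rewrite /underlying (grhD (gr_homP (hS0 f))).
by rewrite (grhD (gr_homP (hS1 f)) x y) addrACA.
Qed.

Fact endS_mulA : associative endS_mul.
Proof. by move=> f g h; apply: compSA. Qed.
Fact endS_mul1l : left_id (idS M) endS_mul.
Proof. by move=> f; apply: compS_idl. Qed.
Fact endS_mul1r : right_id (idS M) endS_mul.
Proof. by move=> f; apply: compS_idr. Qed.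
Fact endS_mulDl : left_distributive endS_mul +%R.
Proof.
move=> f g h; apply: underlying_inj => x.
by rewrite underlyingD !underlying_comp underlyingD underlying_add.
Qed.
Fact endS_mulDr : right_distributive endS_mul +%R.
Proof.
move=> f g h; apply: underlying_inj => x.
by rewrite underlyingD !underlying_comp underlyingD.
Qed.

HB.instance Definition _ := GRing.Zmodule_isPzRing.Build (endS M)
  endS_mulA endS_mul1l endS_mul1r endS_mulDl endS_mulDr.

Lemma underlying_in k x : underlying (endS_in k) x = sa_in A k *: x.
Proof. exact: addr0. Qed.

Fact endS_in_zmod : zmod_morphism endS_in.
Proof.
move=> k l; apply: underlying_inj => x.
rewrite underlyingD !underlying_in rmorphB scalerBl; congr (_ + _).
by rewrite /underlying /= oppr0 addr0.
Qed.
Fact endS_in_monoid : monoid_morphism endS_in.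
Proof.
split=> [|k l]; apply: underlying_inj => x.
  by rewrite underlying_in underlying_id rmorph1 scale1r.
by rewrite underlying_comp !underlying_in scalerA -rmorphM mulrC.
Qed.
HB.instance Definition _ :=
  GRing.isZmodMorphism.Build K (endS M) endS_in endS_in_zmod.
HB.instance Definition _ :=
  GRing.isMonoidMorphism.Build K (endS M) endS_in endS_in_monoid.

Lemma twist_in k : twist S (sa_in A k) = sa_in A k.
Proof. by rewrite /twist; case: S => //; apply/parity0/sa_comp_in. Qed.

Fact endS_central k (f : endS M) : endS_in k * f = f * endS_in k.
Proof.
apply: underlying_inj => x; rewrite !underlying_comp !underlying_in /underlying.
rewrite (grhZ (gr_homP (hS0 f))) scalerDr; congr (_ + _).
rewrite -(grhZ (gr_homP (hS1 f)) (sa_in A k) x).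
by rewrite [in RHS]/GRing.scale /= /shift_scale twist_in.
Qed.

Fact endS_grading : is_grading endS_comp.
Proof.
split.
- by case.
- by case=> f g /= ->; move=> ->; rewrite subr0.
- move=> f; exists (HomS (hS0 f) 0), (HomS 0 (hS1 f)); split=> //.
  by case: f => f0 f1; congr HomS; rewrite /= ?addr0 ?add0r.
- by case=> f0 f1 /= -> ->.
Qed.

Fact endS_compM i j (f g : endS M) :
  endS_comp i f -> endS_comp j g -> endS_comp (i (+) j) (f * g).
Proof.
have z N L (h : gr_hom N L) : h 0 = 0.
  by rewrite -(scale0r (0 : N)) (grhZ (gr_homP h)) scale0r.
case: i; case: j => /= hf hg; apply: gr_hom_eq => x /=; rewrite hf hg /=.
- by rewrite addr0; apply: z.
- by rewrite addr0.
- by rewrite add0r; apply: z.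
- by rewrite add0r; apply: (z _ _ (hS0 g)).
Qed.

Fact endS_compZ i k (f : endS M) : endS_comp i f -> endS_comp i (endS_in k * f).
Proof.
have h : endS_comp false (endS_in k) by [].
by move=> hf; rewrite -(addFb i); apply: endS_compM.
Qed.

Definition EndS : superalgebra K :=
  @Superalgebra K (endS M) endS_in endS_central endS_comp endS_grading
    endS_compZ endS_compM.

End End.
End ModS.

Definition finitely_generated (K : fieldType) (A : superalgebra K)
    (M : grmod A) : Prop :=
  exists s : seq M, forall m : M, exists a : 'I_(size s) -> A,
    m = \sum_(i < size s) a i *: s`_i.

Definition projective (K : fieldType) (A : superalgebra K) (P : grmod A) : Prop :=
  forall (M N : grmod A) (g : gr_hom M N) (f : gr_hom P N),
    (forall n, exists m, g m = n) ->
    exists h : gr_hom P M, comp_hom h g = f.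

(* The notion is only defined for finite dimensional A and B, whence the first
   two clauses. *)
Definition graded_morita_equivalent (K : fieldType) (A B : superalgebra K) :
    Prop :=
  [/\ finite_dimensional A, finite_dimensional B,
      equivalent_categories (Gr A) (Gr B)
    & exists P : grmod A,
        [/\ finitely_generated P, projective P
          & superalgebra_iso B (EndS Sigma P)]].

Section LeftIdeal.
Variables (K : fieldType) (A : superalgebra K) (f : A).

Definition left_ideal_pred : {pred A^o} := fun x => `[< exists a, x = a * f >].

Fact left_ideal_submod : submod_closed left_ideal_pred.
Proof.
split; first by apply/asboolP; exists 0; rewrite mul0r.
move=> a _ _ /asboolP[b ->] /asboolP[c ->]; apply/asboolP.
by exists (a * b + c); rewrite mulrDl -mulrA.
Qed.
HB.instance Definition _ :=
  GRing.isSubmodClosed.Build A A^o left_ideal_pred left_ideal_submod.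

Record left_ideal := LeftIdeal {
  li_val :> A^o;
  li_valP : li_val \in left_ideal_pred }.
HB.instance Definition _ := [isSub for li_val].
HB.instance Definition _ := [Choice of left_ideal by <:].
HB.instance Definition _ := [SubChoice_isSubLmodule of left_ideal by <:].

Hypothesis f_even : sa_comp false f.

Definition left_ideal_comp (i : bool) (x : left_ideal) : Prop :=
  sa_comp i (li_val x : A).

Fact left_ideal_grading : is_grading left_ideal_comp.
Proof.
have g := sa_grading A; split.
- by move=> i; apply: (gr0 g).
- by move=> i x y; apply: (grB g).
- case=> x hx; have /asboolP[a ea] := hx.
  have [a0 [a1 [h0 h1 e]]] := grD g a.
  have i0 : (a0 * f : A^o) \in left_ideal_pred by apply/asboolP; exists a0.
  have i1 : (a1 * f : A^o) \in left_ideal_pred by apply/asboolP; exists a1.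
  exists (LeftIdeal i0), (LeftIdeal i1); split.
  + exact: (sa_compM h0 f_even).
  + exact: (sa_compM h1 f_even).
  + by apply: val_inj; rewrite /= ea e mulrDl.
- by move=> x h0 h1; apply: val_inj; apply: (grI g).
Qed.

Fact left_ideal_compZ i j (a : A) (x : left_ideal) : sa_comp i a ->
  left_ideal_comp j x -> left_ideal_comp (i (+) j) (a *: x).
Proof. by move=> ha hx; apply: (sa_compM ha hx). Qed.

Definition left_ideal_mod : grmod A :=
  @GrMod K A left_ideal left_ideal_comp left_ideal_grading left_ideal_compZ.

End LeftIdeal.

Section Basic.
Variables (K : fieldType) (A : superalgebra K).

(* Primitivity is relative to degree-zero idempotents: inhomogeneous
   idempotents do not decompose Af as a graded module. *)
Definition even_idempotent (f : A) : Prop := sa_comp false f /\ f * f = f.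

Definition primitive (f : A) : Prop :=
  [/\ even_idempotent f, f != 0
    & forall g h : A, even_idempotent g -> even_idempotent h ->
        g * h = 0 -> h * g = 0 -> f = g + h -> g = 0 \/ h = 0].

Record complete_primitive_set n (f : 'I_n -> A) : Prop := CompletePrimitiveSet {
  cps_even : forall i, sa_comp false (f i);
  cps_primitive : forall i, primitive (f i);
  cps_orthogonal : forall i j, i != j -> f i * f j = 0;
  cps_sum : \sum_i f i = 1 }.

Definition S_graded_basic (S : shift) : Prop :=
  exists (n : nat) (f : 'I_n -> A) (hf : complete_primitive_set f),
    forall i j, i != j ->
      ~ @cat_isomorphic (ModS A S) (left_ideal_mod (cps_even hf i))
                                   (left_ideal_mod (cps_even hf j)).

Definition graded_basic : Prop := S_graded_basic Sigma \/ S_graded_basic Pi.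

End Basic.

(* The algebra given by generators and relations: noncommutative polynomial
   expressions in the generators e_i, modulo the least congruence [cl_rel] that
   contains the axioms of unital associative K-algebras and the Clifford
   relations. *)
Section Clifford.
Variables (K : numFieldType) (p q : nat).

Inductive cl_term : Type :=
  | ClScalar of K
  | ClGen of 'I_(p + q)
  | ClAdd of cl_term & cl_term
  | ClMul of cl_term & cl_term.

Local Notation "x +' y" := (ClAdd x y) (at level 50, left associativity).
Local Notation "x *' y" := (ClMul x y) (at level 40, left associativity).
Local Notation c := ClScalar.
Local Notation e := ClGen.

Inductive cl_rel : cl_term -> cl_term -> Prop :=
  | cl_refl x : cl_rel x x
  | cl_sym x y : cl_rel x y -> cl_rel y x
  | cl_trans x y z : cl_rel x y -> cl_rel y z -> cl_rel x z
  | cl_add_congr x x' y y' : cl_rel x x' -> cl_rel y y' -> cl_rel (x +' y) (x' +' y')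
  | cl_mul_congr x x' y y' : cl_rel x x' -> cl_rel y y' -> cl_rel (x *' y) (x' *' y')
  | cl_addA x y z : cl_rel (x +' (y +' z)) (x +' y +' z)
  | cl_addC x y : cl_rel (x +' y) (y +' x)
  | cl_add0 x : cl_rel (c 0 +' x) x
  | cl_addN x : cl_rel (c (-1) *' x +' x) (c 0)
  | cl_mulA x y z : cl_rel (x *' (y *' z)) (x *' y *' z)
  | cl_mul1 x : cl_rel (c 1 *' x) x
  | cl_mulDl x y z : cl_rel ((x +' y) *' z) (x *' z +' y *' z)
  | cl_mulDr x y z : cl_rel (x *' (y +' z)) (x *' y +' x *' z)
  | cl_scalarD k l : cl_rel (c (k + l)) (c k +' c l)
  | cl_scalarM k l : cl_rel (c (k * l)) (c k *' c l)
  | cl_scalarC k x : cl_rel (c k *' x) (x *' c k)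
  | cl_anticomm i j : i != j -> cl_rel (e i *' e j +' e j *' e i) (c 0)
  | cl_sqr1 (i : 'I_(p + q)) : (i < p)%N -> cl_rel (e i *' e i) (c 1)
  | cl_sqr0 (i : 'I_(p + q)) : (p <= i)%N -> cl_rel (e i *' e i) (c 0).

HB.instance Definition _ := gen_eqMixin cl_term.
HB.instance Definition _ := gen_choiceMixin cl_term.

Definition cl_relb (x y : cl_term) : bool := `[< cl_rel x y >].

Fact cl_relb_refl : reflexive cl_relb.
Proof. by move=> x; apply/asboolP; apply: cl_refl. Qed.
Fact cl_relb_sym : symmetric cl_relb.
Proof. by move=> x y; apply/asboolP/asboolP; apply: cl_sym. Qed.
Fact cl_relb_trans : transitive cl_relb.
Proof. by move=> y x z /asboolP h1 /asboolP h2; apply/asboolP/(cl_trans h1). Qed.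
Canonical cl_equiv := EquivRel cl_relb cl_relb_refl cl_relb_sym cl_relb_trans.

Definition cl_quot : Type := {eq_quot cl_equiv}.
HB.instance Definition _ := Choice.on cl_quot.

Definition cl_class (x : cl_term) : cl_quot := \pi_{eq_quot cl_equiv} x.

Lemma cl_classP x y : cl_class x = cl_class y <-> cl_rel x y.
Proof.
split=> [/eqP|h]; first by rewrite eqmodE => /asboolP.
by apply/eqP; rewrite eqmodE; apply/asboolP.
Qed.

Lemma cl_class_surj (a : cl_quot) : exists x, a = cl_class x.
Proof. by exists (repr (a : {eq_quot cl_equiv})); rewrite /cl_class reprK. Qed.

Definition cl_repr (a : cl_quot) : cl_term := repr (a : {eq_quot cl_equiv}).
Lemma cl_reprP x : cl_rel (cl_repr (cl_class x)) x.
Proof. by apply/cl_classP; rewrite /cl_class /cl_repr reprK. Qed.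

Definition cl_add (a b : cl_quot) := cl_class (cl_repr a +' cl_repr b).
Definition cl_mul (a b : cl_quot) := cl_class (cl_repr a *' cl_repr b).
Definition cl_opp (a : cl_quot) := cl_mul (cl_class (c (-1))) a.
Definition cl_in (k : K) : cl_quot := cl_class (c k).

Lemma cl_addE x y : cl_add (cl_class x) (cl_class y) = cl_class (x +' y).
Proof. by apply/cl_classP/cl_add_congr; apply: cl_reprP. Qed.
Lemma cl_mulE x y : cl_mul (cl_class x) (cl_class y) = cl_class (x *' y).
Proof. by apply/cl_classP/cl_mul_congr; apply: cl_reprP. Qed.

Ltac lift_classes := repeat (let a := fresh "a" in
  move=> a; have [? ->] := cl_class_surj a; clear a);
  rewrite /cl_opp /cl_in ?(cl_addE, cl_mulE); apply/cl_classP.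

Fact cl_quot_addA : associative cl_add.
Proof. by lift_classes; apply: cl_addA. Qed.
Fact cl_quot_addC : commutative cl_add.
Proof. by lift_classes; apply: cl_addC. Qed.
Fact cl_quot_add0 : left_id (cl_in 0) cl_add.
Proof. by lift_classes; apply: cl_add0. Qed.
Fact cl_quot_addN : left_inverse (cl_in 0) cl_opp cl_add.
Proof. by lift_classes; apply: cl_addN. Qed.
HB.instance Definition _ := GRing.isZmodule.Build cl_quot
  cl_quot_addA cl_quot_addC cl_quot_add0 cl_quot_addN.

Fact cl_quot_mulA : associative cl_mul.
Proof. by lift_classes; apply: cl_mulA. Qed.
Fact cl_quot_mul1l : left_id (cl_in 1) cl_mul.
Proof. by lift_classes; apply: cl_mul1. Qed.
Fact cl_quot_mul1r : right_id (cl_in 1) cl_mul.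
Proof.
by lift_classes; apply: cl_trans (cl_mul1 _); apply/cl_sym/cl_scalarC.
Qed.
Fact cl_quot_mulDl : left_distributive cl_mul cl_add.
Proof. by lift_classes; apply: cl_mulDl. Qed.
Fact cl_quot_mulDr : right_distributive cl_mul cl_add.
Proof. by lift_classes; apply: cl_mulDr. Qed.
HB.instance Definition _ := GRing.Zmodule_isPzRing.Build cl_quot
  cl_quot_mulA cl_quot_mul1l cl_quot_mul1r cl_quot_mulDl cl_quot_mulDr.

Lemma cl_classD x y : cl_class (x +' y) = cl_class x + cl_class y.
Proof. by rewrite -cl_addE. Qed.
Lemma cl_classM x y : cl_class (x *' y) = cl_class x * cl_class y.
Proof. by rewrite -cl_mulE. Qed.

Fact cl_in_zmod : zmod_morphism cl_in.
Proof.
move=> k l; have -> : cl_in k = cl_in (k - l) + cl_in l.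
  by rewrite /cl_in -cl_classD -{1}[k](subrK l); apply/cl_classP/cl_scalarD.
by rewrite addrK.
Qed.
Fact cl_in_monoid : monoid_morphism cl_in.
Proof.
by split=> // k l; rewrite /cl_in -cl_classM; apply/cl_classP/cl_scalarM.
Qed.
HB.instance Definition _ := GRing.isZmodMorphism.Build K cl_quot cl_in cl_in_zmod.
HB.instance Definition _ :=
  GRing.isMonoidMorphism.Build K cl_quot cl_in cl_in_monoid.

Fact cl_in_central k (a : cl_quot) : cl_in k * a = a * cl_in k.
Proof.
have [x ->] := cl_class_surj a.
by rewrite /cl_in -!cl_classM; apply/cl_classP/cl_scalarC.
Qed.

Definition cl_gen (i : 'I_(p + q)) : cl_quot := cl_class (e i).

(* As the generators are odd, the component of degree b is spanned by the
   monomials whose length has parity b. *)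
Definition cl_comp (b : bool) (a : cl_quot) : Prop :=
  exists s : seq (K * seq 'I_(p + q)),
    all (fun m => odd (size m.2) == b) s /\
    a = \sum_(m <- s) cl_in m.1 * \prod_(i <- m.2) cl_gen i.

(* The endomorphism e_i |-> - e_i, which shows that the two components meet
   in 0. *)
Fixpoint cl_inv (x : cl_term) : cl_quot :=
  match x with
  | ClScalar k => cl_in k
  | ClGen i => - cl_gen i
  | ClAdd x y => cl_inv x + cl_inv y
  | ClMul x y => cl_inv x * cl_inv y
  end.

Lemma cl_inv_rel x y : cl_rel x y -> cl_inv x = cl_inv y.
Proof.
elim=> {x y} //=.
- by move=> x y z _ -> _ ->.
- by move=> x x' y y' _ -> _ ->.
- by move=> x x' y y' _ -> _ ->.
- by move=> x y z; rewrite addrA.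
- by move=> x y; rewrite addrC.
- by move=> x; rewrite add0r.
- by move=> x; rewrite rmorphN1 mulN1r addNr.
- by move=> x y z; rewrite mulrA.
- by move=> x; rewrite mul1r.
- by move=> x y z; rewrite mulrDl.
- by move=> x y z; rewrite mulrDr.
- by move=> k l; rewrite -rmorphD.
- by move=> k l; rewrite -rmorphM.
- by move=> k x; apply: cl_in_central.
- move=> i j hij; rewrite !mulrNN /cl_gen -!cl_classM -cl_classD.
  exact/cl_classP/cl_anticomm.
- by move=> i hi; rewrite !mulrNN /cl_gen -!cl_classM; apply/cl_classP/cl_sqr1.
- by move=> i hi; rewrite !mulrNN /cl_gen -!cl_classM; apply/cl_classP/cl_sqr0.
Qed.

Definition cl_par (a : cl_quot) : cl_quot := cl_inv (cl_repr a).

Lemma cl_parE x : cl_par (cl_class x) = cl_inv x.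
Proof. exact/cl_inv_rel/cl_reprP. Qed.

Lemma cl_parD a b : cl_par (a + b) = cl_par a + cl_par b.
Proof.
have [[x ->] [y ->]] := (cl_class_surj a, cl_class_surj b).
by rewrite -cl_classD !cl_parE.
Qed.
Lemma cl_parM a b : cl_par (a * b) = cl_par a * cl_par b.
Proof.
have [[x ->] [y ->]] := (cl_class_surj a, cl_class_surj b).
by rewrite -cl_classM !cl_parE.
Qed.
Lemma cl_par_in k : cl_par (cl_in k) = cl_in k.
Proof. exact: cl_parE. Qed.

Lemma cl_par_word (w : seq 'I_(p + q)) :
  cl_par (\prod_(i <- w) cl_gen i) = (-1) ^+ odd (size w) * \prod_(i <- w) cl_gen i.
Proof.
elim: w => [|i w IH]; first by rewrite big_nil mulr1 cl_par_in.
rewrite big_cons cl_parM IH cl_parE /= signrN !mulNr mulrA [in RHS]mulrA.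
by congr (- (_ * _)); apply: commr_sign.
Qed.

Lemma cl_par_comp b a : cl_comp b a -> cl_par a = (-1) ^+ b * a.
Proof.
case=> s [+ ->]; elim: s => [_|m s IH /= /andP[/eqP hm hs]].
  by rewrite big_nil mulr0 -(rmorph0 cl_in) cl_par_in.
rewrite big_cons cl_parD IH // cl_parM cl_par_in cl_par_word hm mulrDr.
by congr (_ + _); rewrite !mulrA cl_in_central.
Qed.

Lemma cl_comp0 b : cl_comp b 0.
Proof. by exists [::]; rewrite big_nil. Qed.

Lemma cl_compD b x y : cl_comp b x -> cl_comp b y -> cl_comp b (x + y).
Proof.
move=> [s [hs ->]] [t [ht ->]]; exists (s ++ t).
by rewrite all_cat hs ht big_cat.
Qed.

Fact cl_compZ b k x : cl_comp b x -> cl_comp b (cl_in k * x).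
Proof.
case=> s [hs ->]; exists [seq (k * m.1, m.2) | m <- s]; split.
  by rewrite all_map.
by rewrite big_map mulr_sumr; apply: eq_bigr => m _; rewrite rmorphM mulrA.
Qed.

Fact cl_compM b b' x y :
  cl_comp b x -> cl_comp b' y -> cl_comp (b (+) b') (x * y).
Proof.
move=> [s [hs ->]] [t [ht ->]]; rewrite mulr_suml.
elim: s hs => [_|m s IH /= /andP[/eqP hm hs]].
  by rewrite big_nil; apply: cl_comp0.
rewrite big_cons; apply: cl_compD; last exact: IH.
rewrite -mulrA; apply: cl_compZ; rewrite mulr_sumr.
exists [seq (l.1, m.2 ++ l.2) | l <- t]; split.
  rewrite all_map; apply/allP => l /(allP ht)/eqP /= hl.
  by rewrite size_cat oddD hm hl.
rewrite big_map; apply: eq_bigr => l _ /=.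
by rewrite mulrA -cl_in_central -mulrA big_cat.
Qed.

Fact cl_grading : is_grading cl_comp.
Proof.
split; first exact: cl_comp0.
- move=> b x y hx hy; apply: cl_compD => //.
  by rewrite -mulN1r -(rmorphN1 cl_in); apply: cl_compZ.
- move=> a; have [t ->] := cl_class_surj a.
  elim: t => [k|i|x [x0 [x1 [hx0 hx1 ex]]] y [y0 [y1 [hy0 hy1 ey]]]
               |x [x0 [x1 [hx0 hx1 ex]]] y [y0 [y1 [hy0 hy1 ey]]]].
  + exists (cl_in k), 0; split; [|exact: cl_comp0|by rewrite addr0].
    by exists [:: (k, [::])]; rewrite big_seq1 /= big_nil mulr1.
  + exists 0, (cl_gen i); split; [exact: cl_comp0| |by rewrite add0r].
    by exists [:: (1, [:: i])]; rewrite !big_seq1 /= rmorph1 mul1r.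
  + exists (x0 + y0), (x1 + y1).
    by rewrite cl_classD ex ey addrACA; split=> //; apply: cl_compD.
  + exists (x0 * y0 + x1 * y1), (x0 * y1 + x1 * y0); split.
    * by apply: cl_compD; [apply: (cl_compM hx0 hy0)|apply: (cl_compM hx1 hy1)].
    * by apply: cl_compD; [apply: (cl_compM hx0 hy1)|apply: (cl_compM hx1 hy0)].
    * rewrite cl_classM ex ey mulrDl !mulrDr.
      by rewrite [x1 * y0 + _]addrC addrACA.
- move=> x /cl_par_comp + /cl_par_comp => ->.
  rewrite expr0 mul1r expr1 mulN1r => /eqP; rewrite -addr_eq0 => /eqP h.
  have -> : x = cl_in 2^-1 * (cl_in 2 * x).
    by rewrite mulrA -rmorphM mulVf ?pnatr_eq0 // rmorph1 mul1r.
  by rewrite -[2]/(1 + 1) rmorphD rmorph1 mulrDl mul1r h mulr0.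
Qed.

Definition clifford : superalgebra K :=
  @Superalgebra K cl_quot cl_in cl_in_central cl_comp cl_grading cl_compZ
    cl_compM.

End Clifford.

(* Main.v *)
Require Import Defs.
From HB Require Import structures.
From mathcomp Require Import all_boot all_order all_algebra.
From mathcomp Require Import boolp reals complex.

Set Implicit Arguments.
Unset Strict Implicit.
Unset Printing Implicit Defensive.

Import GRing.Theory Num.Theory.
Local Open Scope ring_scope.

(* Two non-degenerate generators e1, e2 of A = C_{p+2,q} give the even
   idempotent f = (1 + i e1 e2)/2, and u = e1 is an odd involution with
   u f u = 1 - f.  The other generators e commute with e1 e2, hence with f, and
   b |-> b f identifies B = C_{p,q} with f A f = End(Af).  Since 1 = f + u f u,
   the functor M |-> f M is an equivalence from Gr A to Gr B, with inverse
   N |-> N (+) N[1].  Corners of corners are corners, so p can be lowered to its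
   residue modulo 2.  For p <= 1 every even element is a scalar plus a nilpotent
   element (a sum of words containing a degenerate generator), hence 1 is a
   primitive idempotent. *)

(** * Equivalences of categories *)

(** The algebras are given by generators and relations, with no basis at hand. Whatever asserts that
    elements differ (injectivity of the corner map, [1 != 0]) is therefore read off a
    representation, while finite dimension only needs a spanning list. The factor i is forced: e1 e2
    squares to -1, so i e1 e2 is an involution and f is the projection onto its eigenvalue 1. The
    two halves of Morita equivalence are iterated separately. Equivalences of categories compose,
    but a chain of them does not readily produce End(P); corners do compose as maps B -> A, and P =
    A f is formed once, from the final corner. Conversely the equivalence is proved one step at a
    time, because an odd involution u with u f u = 1 - f is available for a single step only. The
    untwisted shift sigma is the right one here: right multiplication by an odd element commutes
    with the left action without a sign. *)

Lemma equivalent_categories_refl (C : category) : equivalent_categories C C.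
Proof.
exists (id_functor C), (id_functor C); split;
  by exists (fun=> cat_id _), (fun=> cat_id _); split=> *;
     rewrite /= ?cat_idl ?cat_idr.
Qed.

(** Stated for one side only: exchanging the roles of the functors and of [C] and [E] gives the
    other natural isomorphism of a composite equivalence. *)
Lemma naturally_isomorphic_conj (C D E : category) (F : functor C D)
    (G : functor D C) (F' : functor D E) (G' : functor E D) :
  naturally_isomorphic (comp_functor F G) (id_functor C) ->
  naturally_isomorphic (comp_functor F' G') (id_functor D) ->
  naturally_isomorphic
    (comp_functor (comp_functor F F') (comp_functor G' G)) (id_functor C).
Proof.
move=> [a [b [ab ba nat_a]]] [a' [b' [ab' ba' nat_a']]].
exists (fun X => cat_comp (fun_map G (a' (F X))) (a X)).
exists (fun X => cat_comp (b X) (fun_map G (b' (F X)))).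
split=> [X|X|X Y f] /=.
- rewrite cat_assoc -(cat_assoc _ (a X)) ab cat_idr -(fun_comp G).
  by rewrite ab' fun_id.
- rewrite cat_assoc -(cat_assoc (b X)) -(fun_comp G) ba' fun_id.
  by rewrite cat_idr ba.
- rewrite cat_assoc -(fun_comp G) (nat_a' _ _ (fun_map F f)) fun_comp.
  by rewrite -!cat_assoc (nat_a _ _ f).
Qed.

Lemma equivalent_categories_trans (D C E : category) :
  equivalent_categories C D -> equivalent_categories D E ->
  equivalent_categories C E.
Proof.
move=> [F [G [h1 h2]]] [F' [G' [h1' h2']]].
exists (comp_functor F F'), (comp_functor G' G).
by split; apply: naturally_isomorphic_conj.
Qed.

(** * Corners *)

(* [psi] identifies [B] with the corner [f A f], where [f] is the even
   idempotent [psi 1]. *)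
Record corner (K : fieldType) (A B : superalgebra K) (psi : B -> A) : Prop :=
  Corner {
    cornerD : {morph psi : a b / a + b};
    cornerM : {morph psi : a b / a * b};
    corner_in : forall k, psi (sa_in B k) = sa_in A k * psi 1;
    corner_comp : forall i b, sa_comp i b -> sa_comp i (psi b);
    corner_inj : injective psi;
    corner_img : forall a, exists b, psi 1 * a * psi 1 = psi b }.

Lemma corner_id (K : fieldType) (A : superalgebra K) :
  corner (fun a : A => a).
Proof. by split=> // [k|a]; [rewrite mulr1|exists a; rewrite mulr1 mul1r]. Qed.

Section Corner.
Variables (K : fieldType) (A B : superalgebra K) (psi : B -> A).
Hypothesis psiP : corner psi.
Local Notation f := (psi 1).

Lemma corner0 : psi 0 = 0.
Proof. by apply: (addIr (psi 0)); rewrite -(cornerD psiP) !add0r. Qed.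

Lemma corner_idl b : f * psi b = psi b.
Proof. by rewrite -(cornerM psiP) mul1r. Qed.

Lemma corner_idr b : psi b * f = psi b.
Proof. by rewrite -(cornerM psiP) mulr1. Qed.

Lemma corner_even : sa_comp false f.
Proof. exact/(corner_comp psiP)/sa_comp1. Qed.

(** The images of the two components of [b] are the components of [psi b]; the one of the wrong
    degree vanishes, and injectivity carries this back to [B]. *)
Lemma corner_comp_inv i b : sa_comp i (psi b) -> sa_comp i b.
Proof.
have gA := sa_grading A; have [b0 [b1 [h0 h1 ->]]] := grD (sa_grading B) b.
have [k0 k1] := (corner_comp psiP h0, corner_comp psiP h1).
rewrite (cornerD psiP); case: i => h.
  have : psi b0 = 0.
    by apply: (grI gA) => //; rewrite -(addrK (psi b1) (psi b0));
       apply: (grB gA).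
  by rewrite -corner0 => /(corner_inj psiP) ->; rewrite add0r.
have : psi b1 = 0.
  by apply: (grI gA) => //; rewrite -(addKr (psi b0) (psi b1)) addrC;
     apply: (grB gA).
by rewrite -corner0 => /(corner_inj psiP) ->; rewrite addr0.
Qed.

(** The compression [a |-> f * a * f] read in [B]. It is defined on all of [A] and is additive, but
    products acquire an [f] in the middle ([corner_invM]). *)
Definition corner_inv (a : A) : B := sval (cid (corner_img psiP a)).
Local Notation beta := corner_inv.

Lemma corner_invK a : psi (beta a) = f * a * f.
Proof. by rewrite /beta; case: cid => b /= ->. Qed.

Lemma cornerK b : beta (psi b) = b.
Proof.
by apply: (corner_inj psiP); rewrite corner_invK corner_idl corner_idr.
Qed.

Lemma corner_invD a b : beta (a + b) = beta a + beta b.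
Proof.
by apply: (corner_inj psiP); rewrite (cornerD psiP) !corner_invK mulrDr mulrDl.
Qed.

Lemma corner_invM a b : beta a * beta b = beta (a * f * b).
Proof.
apply: (corner_inj psiP); rewrite (cornerM psiP) !corner_invK.
by rewrite -!mulrA (mulrA f f) corner_idl.
Qed.

Lemma corner_inv1 : beta 1 = 1.
Proof. by apply: (corner_inj psiP); rewrite corner_invK mulr1 corner_idl. Qed.

Lemma corner_inv_comp i a : sa_comp i a -> sa_comp i (beta a).
Proof.
move=> ha; apply: corner_comp_inv; rewrite corner_invK -(addbF i) -(addFb i).
by apply: sa_compM corner_even; apply: sa_compM ha; apply: corner_even.
Qed.

End Corner.

(** The idempotent of the composite lies under that of [psi], so compressing by it can be done in
    two stages, first to [B] and then to [C]. *)
Lemma corner_trans (K : fieldType) (A B C : superalgebra K) (psi : B -> A)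
    (psi' : C -> B) :
  corner psi -> corner psi' -> corner (psi \o psi').
Proof.
move=> h h'; split=> /=.
- by move=> a b; rewrite /= (cornerD h') (cornerD h).
- by move=> a b; rewrite /= (cornerM h') (cornerM h).
- by move=> k; rewrite (corner_in h') (cornerM h) (corner_in h) -mulrA
    corner_idl.
- by move=> i b hb; apply/(corner_comp h)/(corner_comp h').
- by move=> a b /(corner_inj h)/(corner_inj h').
- move=> a; have [b eb] := corner_img h' (corner_inv h a); exists b.
  rewrite -eb !(cornerM h) corner_invK !mulrA corner_idr // -!mulrA.
  by rewrite corner_idl.
Qed.

(** * The left ideal of an even idempotent and its graded endomorphisms *)

Section LeftIdealModule.
Variables (K : fieldType) (A : superalgebra K) (f : A).
Hypotheses (f_even : sa_comp false f) (ff : f * f = f).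
Local Notation P := (left_ideal_mod f_even).

Fact left_ideal_gen_subproof : (f : A^o) \in left_ideal_pred f.
Proof. by apply/asboolP; exists 1; rewrite mul1r. Qed.
Definition left_ideal_gen : P := LeftIdeal left_ideal_gen_subproof.

Lemma left_ideal_idr (x : P) : (li_val x : A) * f = li_val x.
Proof.
by have /asboolP[a ->] := li_valP x; rewrite -mulrA ff.
Qed.

Lemma left_ideal_genE (x : P) : x = (li_val x : A) *: left_ideal_gen.
Proof. by apply: val_inj; rewrite /= -[LHS]left_ideal_idr. Qed.

Lemma left_ideal_fg : finitely_generated P.
Proof.
exists [:: left_ideal_gen] => m; exists (fun=> li_val m).
by rewrite big_ord1; apply: left_ideal_genE.
Qed.

(** A morphism out of [P] is determined by the image of its generator [f], so it is enough to lift
    that one element. *)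
Lemma left_ideal_proj : projective P.
Proof.
move=> M N g h surj; have [gP hP] := (gr_homP g, gr_homP h).
have [m em] := surj (h left_ideal_gen).
(* The preimage [m] may have an odd part; its even part is still a preimage, because
   [h left_ideal_gen] is even. *)
have [m0 [m1 [h0 h1 e]]] := grD (gm_grading M) m.
have e0 : g m0 = h left_ideal_gen.
  rewrite e (grhD gP) -[RHS]addr0 in em.
  have [] := gr_uniq (gm_grading N) (grh_comp gP h0) (grh_comp gP h1) _ _ em.
  - exact/(grh_comp hP).
  - exact: (gr0 (gm_grading N)).
  - by [].
have k_hom : is_gr_hom (fun x : P => (li_val x : A) *: m0).
  split=> [x y|a x|i x hx].
  - by rewrite /= scalerDl.
  - by rewrite scalerA.
  - by rewrite -(addbF i); apply: gm_compZ.
exists (GrHom k_hom); apply: gr_hom_eq => x /=.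
by rewrite (grhZ gP) e0 -(grhZ hP) -left_ideal_genE.
Qed.

End LeftIdealModule.

Section CornerEnd.
Variables (K : fieldType) (A B : superalgebra K) (psi : B -> A).
Hypothesis psiP : corner psi.
Local Notation P := (left_ideal_mod (corner_even psiP)).
Local Notation E := (EndS Sigma P).

Fact rmul_subproof (b : B) (x : P) :
  ((li_val x : A) * psi b : A^o) \in left_ideal_pred (psi 1).
Proof.
by apply/asboolP; exists (li_val x * psi b); rewrite -mulrA corner_idr.
Qed.
Definition rmul b (x : P) : P := LeftIdeal (rmul_subproof b x).

Lemma rmulD b x y : rmul b (x + y) = rmul b x + rmul b y.
Proof. by apply: val_inj; rewrite /= mulrDl. Qed.

Lemma rmulZ b (a : A) x : rmul b (a *: x) = a *: rmul b x.
Proof. by apply: val_inj; rewrite /= /GRing.scale /= mulrA. Qed.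

Lemma rmul_comp i j b x : sa_comp j b -> gm_comp i x ->
  gm_comp (i (+) j) (rmul b x).
Proof. by move=> hb hx; apply: (sa_compM hx); apply: corner_comp. Qed.

(** Right multiplication by the even part of [b] preserves degrees and the odd part gives a morphism
    out of the sigma-shift. The parts are only known to exist, whence an existence statement;
    [underlying_inj] makes the result unique. *)
Lemma ex_endS_rmul (b : B) : exists g : E,
  (forall x, underlying g x = rmul b x) /\
  (forall i, sa_comp i b -> sa_comp i g).
Proof.
have [b0 [b1 [h0 h1 e]]] := grD (sa_grading B) b.
have hom0 : is_gr_hom (rmul b0).
  split=> [x y|a x|i x hx]; [exact: rmulD|exact: rmulZ|].
  by rewrite -(addbF i); apply: rmul_comp.
have hom1 : @is_gr_hom K A (shift_mod Sigma P) P (rmul b1).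
  split=> [x y|a x|i x hx]; [exact: rmulD|exact: rmulZ|].
  by rewrite -(addbK true i); apply: rmul_comp.
exists (HomS (GrHom hom0) (GrHom hom1)); split=> [x|i hb].
  by apply: val_inj; rewrite /= -mulrDr -(cornerD psiP) -e.
have gB := sa_grading B.
have zero : i = false /\ b1 = 0 \/ i = true /\ b0 = 0.
  case: i hb => hb; [right|left]; split=> //.
    have := gr_uniq gB h0 h1 (gr0 gB false) hb; rewrite add0r => [] [] //.
  have := gr_uniq gB h0 h1 hb (gr0 gB true); rewrite addr0 => [] [] //.
case: zero => -[-> z]; apply: gr_hom_eq => x; apply: val_inj => /=;
  by rewrite z (corner0 psiP) mulr0.
Qed.

Definition endS_rmul (b : B) : E := sval (cid (ex_endS_rmul b)).

Lemma endS_rmulE b x : underlying (endS_rmul b) x = rmul b x.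
Proof. by rewrite /endS_rmul; case: cid => g /= []. Qed.

Lemma endS_rmul_comp i b : sa_comp i b -> sa_comp i (endS_rmul b).
Proof. by rewrite /endS_rmul; case: cid => g /= [_ h]; apply: h. Qed.

Fact endS_rmul_zmod : zmod_morphism endS_rmul.
Proof.
have D a b : endS_rmul (a + b) = endS_rmul a + endS_rmul b.
  apply: underlying_inj => x; rewrite underlyingD !endS_rmulE.
  by apply: val_inj; rewrite /= (cornerD psiP) mulrDr.
by move=> a b; apply/esym; rewrite -{1}(subrK b a) D addrK.
Qed.

Fact endS_rmul_monoid : monoid_morphism endS_rmul.
Proof.
split=> [|a b]; apply: underlying_inj => x.
  rewrite endS_rmulE underlying_id; apply: val_inj => /=.
  by apply: left_ideal_idr; apply: corner_idl.
rewrite underlying_comp !endS_rmulE; apply: val_inj => /=.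
by rewrite (cornerM psiP) mulrA.
Qed.

HB.instance Definition _ :=
  GRing.isZmodMorphism.Build B E endS_rmul endS_rmul_zmod.
HB.instance Definition _ :=
  GRing.isMonoidMorphism.Build B E endS_rmul endS_rmul_monoid.

(** Evaluation at the generator [f] recovers [b], and an endomorphism [g] is right multiplication by
    its value at [f], which lies in [f A f] because [f] is idempotent. Maps written on the right
    make this a morphism rather than an anti-morphism. *)
Lemma corner_iso_End : superalgebra_iso B E.
Proof.
have ff := corner_idl psiP 1; pose e0 : P := left_ideal_gen (corner_even psiP).
have inj a b : endS_rmul a = endS_rmul b -> a = b.
  move=> e; apply: (corner_inj psiP).
  have : rmul a e0 = rmul b e0 by rewrite -!endS_rmulE e.
  by move=> /(congr1 (@li_val _ _ _)) /=; rewrite !(corner_idl psiP).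
have surj (g : E) : exists b, endS_rmul b = g.
  have gZ (a : A) x : underlying g (a *: x) = a *: underlying g x.
    rewrite /underlying (grhZ (gr_homP (hS0 g))).
    by rewrite (grhZ (gr_homP (hS1 g)) a x) scalerDr.
  have [b eb] := corner_img psiP (li_val (underlying g e0)).
  exists b; apply: underlying_inj => x; rewrite endS_rmulE.
  rewrite [in RHS](left_ideal_genE ff x) gZ; apply: val_inj => /=.
  rewrite -eb -[in RHS](left_ideal_idr ff x) -/e0 /GRing.scale /=.
  rewrite -!mulrA; congr (_ * (_ * _)).
  exact: (left_ideal_idr ff (underlying g e0)).
exists endS_rmul; split.
- pose h g := sval (cid (surj g)).
  have hK g : endS_rmul (h g) = g by rewrite /h; case: cid.
  by exists h => // b; apply: inj; rewrite hK.
- move=> k; apply: underlying_inj => x; rewrite endS_rmulE underlying_in.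
  apply: val_inj; rewrite /= (corner_in psiP) mulrA -sa_central -mulrA.
  by rewrite left_ideal_idr.
- exact: endS_rmul_comp.
Qed.

Lemma corner_proj_End :
  exists P : grmod A,
    [/\ finitely_generated P, projective P
      & superalgebra_iso B (EndS Sigma P)].
Proof.
have ff := corner_idl psiP 1; exists P; split.
- exact: left_ideal_fg.
- exact: left_ideal_proj.
- exact: corner_iso_End.
Qed.

End CornerEnd.

(** * Graded modules over a full corner *)

(** Only the degrees need care: [g] sends the components of [h x] to those of [x], so the component
    of the wrong degree has image 0 and vanishes by injectivity. *)
Lemma gr_hom_inverse (K : fieldType) (A : superalgebra K) (M N : grmod A)
    (g : M -> N) (h : N -> M) :
  is_gr_hom g -> cancel g h -> cancel h g -> is_gr_hom h.
Proof.
move=> gP gK hK; split=> [x y|a x|i x hx]; apply: (can_inj gK) || idtac.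
- by rewrite (grhD gP) !hK.
- by rewrite (grhZ gP) !hK.
have gM := gm_grading M; have gN := gm_grading N.
have g0 : g 0 = 0 by apply: (addIr (g 0)); rewrite -(grhD gP) !add0r.
have [y0 [y1 [h0 h1 e]]] := grD gM (h x).
have [k0 k1] := (grh_comp gP h0, grh_comp gP h1).
have ex : x = g y0 + g y1 by rewrite -(grhD gP) -e hK.
rewrite e; case: i hx => hx.
  have := gr_uniq gN (gr0 gN false) hx k0 k1; rewrite add0r => /(_ ex)[z _].
  by rewrite -(gK y0) -z -g0 gK add0r.
have := gr_uniq gN hx (gr0 gN true) k0 k1; rewrite addr0 => /(_ ex)[_ z].
by rewrite -(gK y1) -z -g0 gK addr0.
Qed.

Section CornerEquivalence.
Variables (K : fieldType) (A B : superalgebra K) (psi : B -> A).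
Hypothesis psiP : corner psi.
Local Notation f := (psi 1).
Local Notation beta := (corner_inv psiP).

Section Restriction.
Variable M : lmodType A.

(** This is [f M], since [f] is idempotent. It is stable under [f A f] only, so it is a [B]-module
    and not an [A]-submodule. *)
Definition fixed_pred : {pred M} := fun m => f *: m == m.

Fact fixed_zmod : zmod_closed fixed_pred.
Proof.
split=> [|x y /eqP hx /eqP hy]; apply/eqP; first by rewrite scaler0.
by rewrite scalerBr hx hy.
Qed.
HB.instance Definition _ :=
  GRing.isZmodClosed.Build M fixed_pred fixed_zmod.

Record fixed := Fixed { fx_val :> M; fx_valP : fx_val \in fixed_pred }.
HB.instance Definition _ := [isSub for fx_val].
HB.instance Definition _ := [Choice of fixed by <:].
HB.instance Definition _ := [SubChoice_isSubZmodule of fixed by <:].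

Lemma fixedE (x : fixed) : f *: fx_val x = fx_val x.
Proof. exact/eqP/(fx_valP x). Qed.

Fact fixed_scale_subproof (b : B) (x : fixed) :
  psi b *: fx_val x \in fixed_pred.
Proof. by apply/eqP; rewrite scalerA corner_idl. Qed.
Definition fixed_scale b x : fixed := Fixed (fixed_scale_subproof b x).

Fact fixed_scaleA a b x :
  fixed_scale a (fixed_scale b x) = fixed_scale (a * b) x.
Proof. by apply: val_inj; rewrite /= scalerA (cornerM psiP). Qed.
Fact fixed_scale1 : left_id 1 fixed_scale.
Proof. by move=> x; apply: val_inj; rewrite /= fixedE. Qed.
Fact fixed_scaleDr : right_distributive fixed_scale +%R.
Proof. by move=> a x y; apply: val_inj; rewrite /= scalerDr. Qed.
Fact fixed_scaleDl x : {morph fixed_scale^~ x : a b / a + b}.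
Proof. by move=> a b; apply: val_inj; rewrite /= (cornerD psiP) scalerDl. Qed.

HB.instance Definition _ := GRing.Zmodule_isLmodule.Build B fixed
  fixed_scaleA fixed_scale1 fixed_scaleDr fixed_scaleDl.

End Restriction.

Section RestrictionGr.
Variable M : grmod A.

Definition fixed_comp (i : bool) (x : fixed M) : Prop := gm_comp i (fx_val x).

Fact fixed_grading : is_grading fixed_comp.
Proof.
have g := gm_grading M; split.
- by move=> i; apply: (gr0 g).
- by move=> i x y; apply: (grB g).
- move=> x; have [m0 [m1 [h0 h1 e]]] := grD g (fx_val x).
  have [k0 k1] := (gm_compZ (corner_even psiP) h0, gm_compZ (corner_even psiP)
    h1).
  have F (m : M) : f *: m \in @fixed_pred M by apply/eqP;
    rewrite scalerA corner_idl.
  exists (Fixed (F m0)), (Fixed (F m1)); split=> //.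
  by apply: val_inj; rewrite /= -scalerDr -e fixedE.
- by move=> x h0 h1; apply: val_inj; apply: (grI g).
Qed.

Fact fixed_compZ i j (b : B) (x : fixed M) :
  sa_comp i b -> fixed_comp j x -> fixed_comp (i (+) j) (b *: x).
Proof. by move=> hb hx; apply: (gm_compZ _ hx); apply: corner_comp. Qed.

Definition fixed_mod : grmod B :=
  @GrMod K B (fixed M) fixed_comp fixed_grading fixed_compZ.

End RestrictionGr.

Section RestrictionHom.
Variables (M N : grmod A) (g : gr_hom M N).

Fact fixed_map_subproof (x : fixed M) : g (fx_val x) \in @fixed_pred N.
Proof. by apply/eqP; rewrite -(grhZ (gr_homP g)) fixedE. Qed.
Definition fixed_map (x : fixed_mod M) : fixed_mod N :=
  Fixed (fixed_map_subproof x).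

Fact fixed_map_hom : is_gr_hom fixed_map.
Proof.
have gP := gr_homP g; split=> [x y|b x|i x hx].
- by apply: val_inj; rewrite /= (grhD gP).
- by apply: val_inj; rewrite /= (grhZ gP).
- exact: (grh_comp gP).
Qed.
Definition fixed_hom : gr_hom (fixed_mod M) (fixed_mod N) :=
  GrHom fixed_map_hom.

End RestrictionHom.

Fact fixed_hom_id (M : grmod A) :
  fixed_hom (id_hom M) = id_hom (fixed_mod M).
Proof. by apply: gr_hom_eq => x; apply: val_inj. Qed.
Fact fixed_hom_comp (M N L : grmod A) (g : gr_hom M N) (h : gr_hom N L) :
  fixed_hom (comp_hom g h) = comp_hom (fixed_hom g) (fixed_hom h).
Proof. by apply: gr_hom_eq => x; apply: val_inj. Qed.

Definition fixed_functor : functor (Gr A) (Gr B) :=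
  @Functor (Gr A) (Gr B) fixed_mod fixed_hom fixed_hom_id fixed_hom_comp.

Variable u : A.
Hypotheses (u_odd : sa_comp true u) (uu : u * u = 1)
  (ufu : u * f * u = 1 - f).

(** Conjugation by [u] exchanges [f] and [1 - f], so [u] has no diagonal block. *)
Lemma corner_mul_u0 : f * u * f = 0.
Proof.
have -> : f * u * f = f * (u * f * u) * u by rewrite -!mulrA uu mulr1.
by rewrite ufu mulrBr mulr1 corner_idl // subrr mul0r.
Qed.

Section Inflation.
Variable N : lmodType B.

Definition inflated : Type := (N * N)%type.
HB.instance Definition _ := GRing.Zmodule.on inflated.

(* The second factor of [N * N] stands for [u N]: the action is that of the
   matrix of [a] for the decomposition [1 = f + u f u]. *)
Definition inflated_scale (a : A) (x : inflated) : inflated :=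
  (beta a *: x.1 + beta (a * u) *: x.2,
   beta (u * a) *: x.1 + beta (u * a * u) *: x.2).

(** Inserting [1 = f + u * f * u] between [a] and [b] gives the product rule for block matrices,
    which makes [inflated_scale] an action. *)
Lemma corner_inv_split a b :
  beta (a * b) = beta a * beta b + beta (a * u) * beta (u * b).
Proof.
rewrite !corner_invM -corner_invD; congr (beta _).
have -> : a * u * f * (u * b) = a * (u * f * u) * b by rewrite !mulrA.
by rewrite ufu mulrBr mulr1 mulrBl addrC subrK.
Qed.

Lemma corner_inv_u : beta u = 0.
Proof.
by apply: (corner_inj psiP); rewrite corner_invK corner_mul_u0 corner0.
Qed.

Fact inflated_scaleA a b x :
  inflated_scale a (inflated_scale b x) = inflated_scale (a * b) x.
Proof.
congr pair; rewrite /= !scalerDr !scalerA addrACA -!scalerDl.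
  have e1 := corner_inv_split a b; have e2 := corner_inv_split a (b * u).
  by rewrite !mulrA in e2 *; rewrite -e1 -e2.
have e1 := corner_inv_split (u * a) b.
have e2 := corner_inv_split (u * a) (b * u).
by rewrite !mulrA in e1 e2 *; rewrite -e1 -e2.
Qed.
Fact inflated_scale1 : left_id 1 inflated_scale.
Proof.
case=> x y; congr pair; rewrite /= ?mul1r ?mulr1 ?uu corner_inv_u corner_inv1.
  by rewrite scale1r scale0r addr0.
by rewrite scale1r scale0r add0r.
Qed.
Fact inflated_scaleDr : right_distributive inflated_scale +%R.
Proof. by move=> a x y; congr pair; rewrite /= !scalerDr addrACA. Qed.
Fact inflated_scaleDl x : {morph inflated_scale^~ x : a b / a + b}.
Proof.
move=> a b; congr pair;
  by rewrite /= ?mulrDr ?mulrDl !corner_invD !scalerDl addrACA.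
Qed.

HB.instance Definition _ := GRing.Zmodule_isLmodule.Build A inflated
  inflated_scaleA inflated_scale1 inflated_scaleDr inflated_scaleDl.

End Inflation.

Section InflationGr.
Variable N : grmod B.

(** The second factor is shifted because it stands for [u N] with [u] odd. *)
Definition inflated_comp (i : bool) (x : inflated N) : Prop :=
  gm_comp i (x.1 : N) /\ gm_comp (i (+) true) (x.2 : N).

Fact inflated_grading : is_grading inflated_comp.
Proof.
have g := gm_grading N; split.
- by move=> i; split; apply: (gr0 g).
- by move=> i x y [h1 h2] [k1 k2]; split; apply: (grB g).
- case=> n m; have [n0 [n1 [h0 h1 ->]]] := grD g n.
  have [m0 [m1 [k0 k1 ->]]] := grD g m.
  by exists (n0, m1), (n1, m0); split=> //; congr pair; rewrite addrC.
- by case=> n m [/= h0 k1] [/= h1 k0]; congr pair; apply: (grI g).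
Qed.

Fact inflated_compZ i j (a : A) (x : inflated N) :
  sa_comp i a -> inflated_comp j x -> inflated_comp (i (+) j) (a *: x).
Proof.
move=> ha [h1 h2].
have hau := sa_compM ha u_odd; have hua := sa_compM u_odd ha.
have huau := sa_compM hua u_odd.
have [b1 b2] := (corner_inv_comp psiP ha, corner_inv_comp psiP hau).
have [b3 b4] := (corner_inv_comp psiP hua, corner_inv_comp psiP huau).
split; apply: (grA (gm_grading N)).
- exact: (gm_compZ b1 h1).
- by have := gm_compZ b2 h2; rewrite addbACA addbb addbF.
- by have := gm_compZ b3 h1; rewrite (addbC true) -addbA (addbC true) addbA.
- have := gm_compZ b4 h2; rewrite (addbC true) addbK.
  by rewrite addbA.
Qed.

Definition inflated_mod : grmod A :=
  @GrMod K A (inflated N) inflated_comp inflated_grading inflated_compZ.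

End InflationGr.

Section InflationHom.
Variables (M N : grmod B) (g : gr_hom M N).

Definition inflated_map (x : inflated_mod M) : inflated_mod N :=
  (g x.1, g x.2).

Fact inflated_map_hom : is_gr_hom inflated_map.
Proof.
have gP := gr_homP g; split=> [x y|a x|i x [h1 h2]].
- by congr pair; rewrite /= (grhD gP).
- by congr pair; rewrite /= (grhD gP) !(grhZ gP).
- by split; apply: (grh_comp gP).
Qed.
Definition inflated_hom : gr_hom (inflated_mod M) (inflated_mod N) :=
  GrHom inflated_map_hom.

End InflationHom.

Fact inflated_hom_id (M : grmod B) :
  inflated_hom (id_hom M) = id_hom (inflated_mod M).
Proof. by apply: gr_hom_eq => -[]. Qed.
Fact inflated_hom_comp (M N L : grmod B) (g : gr_hom M N) (h : gr_hom N L) :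
  inflated_hom (comp_hom g h) = comp_hom (inflated_hom g) (inflated_hom h).
Proof. exact: gr_hom_eq. Qed.

Definition inflated_functor : functor (Gr B) (Gr A) :=
  @Functor (Gr B) (Gr A) inflated_mod inflated_hom inflated_hom_id
    inflated_hom_comp.

Section Unit.
Variable M : grmod A.
Local Notation GF := (inflated_mod (fixed_mod M)).

(** The decomposition of [M] as the sum of [f M] and [u f M]; the coordinates of [m] are [f m] and
    [f u m]. *)
Definition unit_map (x : GF) : M := fx_val x.1 + u *: fx_val x.2.

Fact fixed_mulr_subproof (a : A) (m : M) : (f * a) *: m \in @fixed_pred M.
Proof. by apply/eqP; rewrite scalerA mulrA corner_idl. Qed.

Definition unit_inv (m : M) : GF :=
  (Fixed (fixed_mulr_subproof 1 m), Fixed (fixed_mulr_subproof u m)).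

Lemma unit_mapK : cancel unit_map unit_inv.
Proof.
case=> x y; congr pair; apply: val_inj;
  rewrite /= /unit_map /= scalerDr !scalerA ?mulr1 -?(mulrA f u) ?uu ?mulr1.
  rewrite fixedE -[X in (f * u) *: X]fixedE scalerA corner_mul_u0 scale0r addr0
    //.
by rewrite fixedE -[X in (f * u) *: X]fixedE scalerA corner_mul_u0 scale0r
  add0r.
Qed.

Lemma unit_invK : cancel unit_inv unit_map.
Proof.
move=> m; rewrite /unit_map /= scalerA mulr1 mulrA ufu scalerBl scale1r.
by rewrite addrC subrK.
Qed.

Fact unit_map_hom : is_gr_hom unit_map.
Proof.
split=> [x y|a x|i x [h1 h2]].
- by rewrite /unit_map /= scalerDr addrACA.
- rewrite /unit_map /= !corner_invK; set x1 := fx_val _; set x2 := fx_val _.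
  (* The unit [f + u * f * u] is inserted to the left of [a] and [f] to its right, where it fixes
     [x1] and [x2]; the four blocks of [a] then appear. *)
  have ex : a *: (x1 + u *: x2) =
    (f + u * f * u) *: (a *: (f *: x1) + (a * u) *: (f *: x2)).
    by rewrite ufu (addrC f) subrK scale1r !fixedE scalerDr scalerA.
  rewrite ex scalerDl !scalerDr !scalerA.
  by congr (_ + _); rewrite !mulrA.
- apply: (grA (gm_grading M)) => //.
  by have := gm_compZ u_odd h2; rewrite addbC addbK.
Qed.

End Unit.

Section Counit.
Variable N : grmod B.
Local Notation FG := (fixed_mod (inflated_mod N)).

Definition counit_map (x : FG) : N := (fx_val x).1.

Lemma corner_inv_uf : beta (u * f) = 0.
Proof.
by apply: (corner_inj psiP); rewrite corner_invK mulrA corner_mul_u0 mul0r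
  corner0.
Qed.

Lemma fixed_inflated (n : N) : ((n, 0) : inflated_mod N) \in @fixed_pred _.
Proof.
apply/eqP; congr pair => /=; rewrite scaler0 addr0.
  by rewrite cornerK scale1r.
by rewrite corner_inv_uf scale0r.
Qed.
Definition counit_inv (n : N) : FG := Fixed (fixed_inflated n).

Lemma counit_invK : cancel counit_inv counit_map.
Proof. by []. Qed.

(** In the second row of the matrix of [f] both entries vanish: they compress [u * f] and
    [u * f * u = 1 - f], and [x] is fixed by [f]. *)
Lemma fixed_inflated2 (x : FG) : (fx_val x).2 = 0.
Proof.
have ufu0 : beta (u * f * u) = 0.
  apply: (corner_inj psiP); rewrite corner_invK ufu mulrBr mulr1.
  by rewrite corner_idl // subrr mul0r corner0.
by rewrite -fixedE /= ufu0 scale0r addr0 corner_inv_uf scale0r.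
Qed.

Lemma counit_mapK : cancel counit_map counit_inv.
Proof.
move=> x; apply: val_inj; rewrite /= /counit_map -(fixed_inflated2 x).
by case: (fx_val x).
Qed.

Fact counit_map_hom : is_gr_hom counit_map.
Proof.
split=> [x y|b x|i x []] //.
by rewrite /counit_map /= fixed_inflated2 scaler0 addr0 cornerK.
Qed.

End Counit.

Lemma corner_equivalence : equivalent_categories (Gr A) (Gr B).
Proof.
exists fixed_functor, inflated_functor; split.
  exists (fun M => GrHom (unit_map_hom M)).
  exists (fun M => GrHom (gr_hom_inverse (unit_map_hom M) (@unit_mapK M)
    (@unit_invK M))).
  split=> [M|M|M N g]; apply: gr_hom_eq => x.
  - exact: unit_mapK.
  - exact: unit_invK.
  - by have gP := gr_homP g; rewrite /= /unit_map (grhD gP) (grhZ gP).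
exists (fun N => GrHom (counit_map_hom N)).
exists (fun N => GrHom (gr_hom_inverse (counit_map_hom N) (@counit_mapK N)
  (@counit_invK N))).
by split=> [M|M|M N g]; apply: gr_hom_eq => x //; apply: counit_mapK.
Qed.

End CornerEquivalence.

(** * Clifford superalgebras *)

Section CliffordTheory.
Variables (K : numFieldType) (p q : nat).
Local Notation Cl := (cl_quot K p q).
Local Notation c := (@cl_in K p q).
Local Notation e := (@cl_gen K p q).

Lemma cl_quot_ind (P : Cl -> Prop) :
  (forall k, P (c k)) -> (forall i, P (e i)) ->
  (forall a b, P a -> P b -> P (a + b)) ->
  (forall a b, P a -> P b -> P (a * b)) -> forall a, P a.
Proof.
move=> hc he hD hM a; have [t ->] := cl_class_surj a.
elim: t => [k|i|x hx y hy|x hx y hy]; [exact: hc|exact: he|..].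
  by rewrite cl_classD; apply: hD.
by rewrite cl_classM; apply: hM.
Qed.

Lemma cl_gen_anticomm i j : i != j -> e i * e j = - (e j * e i).
Proof.
move=> hij; apply/eqP; rewrite -addr_eq0; apply/eqP.
by rewrite /cl_gen -!cl_classM -cl_classD; apply/cl_classP/cl_anticomm.
Qed.

Lemma cl_gen_sqr1 (i : 'I_(p + q)) : (i < p)%N -> e i * e i = 1.
Proof. by move=> hi; rewrite /cl_gen -cl_classM; apply/cl_classP/cl_sqr1. Qed.

Lemma cl_gen_sqr0 (i : 'I_(p + q)) : (p <= i)%N -> e i * e i = 0.
Proof. by move=> hi; rewrite /cl_gen -cl_classM; apply/cl_classP/cl_sqr0. Qed.

Lemma cl_comp_gen i : cl_comp true (e i).
Proof. by exists [:: (1, [:: i])]; rewrite !big_seq1 /= rmorph1 mul1r. Qed.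

Section Lift.
Variables (T : pzRingType) (g : {rmorphism K -> T}) (x : 'I_(p + q) -> T).
Hypotheses (g_central : forall k a, g k * a = a * g k)
  (x_anticomm : forall i j, i != j -> x i * x j + x j * x i = 0)
  (x_sqr1 : forall i : 'I_(p + q), (i < p)%N -> x i * x i = 1)
  (x_sqr0 : forall i : 'I_(p + q), (p <= i)%N -> x i * x i = 0).

Fixpoint cl_eval (t : cl_term K p q) : T :=
  match t with
  | ClScalar k => g k
  | ClGen i => x i
  | ClAdd t1 t2 => cl_eval t1 + cl_eval t2
  | ClMul t1 t2 => cl_eval t1 * cl_eval t2
  end.

Lemma cl_eval_rel t1 t2 : cl_rel t1 t2 -> cl_eval t1 = cl_eval t2.
Proof.
elim=> {t1 t2} //=.
- by move=> t1 t2 t3 _ -> _ ->.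
- by move=> t1 t1' t2 t2' _ -> _ ->.
- by move=> t1 t1' t2 t2' _ -> _ ->.
- by move=> t1 t2 t3; rewrite addrA.
- by move=> t1 t2; rewrite addrC.
- by move=> t; rewrite rmorph0 add0r.
- by move=> t; rewrite rmorphN1 mulN1r addNr rmorph0.
- by move=> t1 t2 t3; rewrite mulrA.
- by move=> t; rewrite rmorph1 mul1r.
- by move=> t1 t2 t3; rewrite mulrDl.
- by move=> t1 t2 t3; rewrite mulrDr.
- by move=> k l; rewrite rmorphD.
- by move=> k l; rewrite rmorphM.
- by move=> i j hij; rewrite x_anticomm // rmorph0.
- by move=> i hi; rewrite x_sqr1 // rmorph1.
- by move=> i hi; rewrite x_sqr0 // rmorph0.
Qed.

Definition cl_lift_fun (a : Cl) : T := cl_eval (cl_repr a).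

Lemma cl_lift_funE t : cl_lift_fun (cl_class t) = cl_eval t.
Proof. exact/cl_eval_rel/cl_reprP. Qed.

Fact cl_lift_fun_zmod : zmod_morphism cl_lift_fun.
Proof.
have D a b : cl_lift_fun (a + b) = cl_lift_fun a + cl_lift_fun b.
  have [[s ->] [t ->]] := (cl_class_surj a, cl_class_surj b).
  by rewrite -cl_classD !cl_lift_funE.
by move=> a b; apply/esym; rewrite -{1}(subrK b a) D addrK.
Qed.

Fact cl_lift_fun_monoid : monoid_morphism cl_lift_fun.
Proof.
split=> [|a b]; first by rewrite [LHS]cl_lift_funE /= rmorph1.
have [[s ->] [t ->]] := (cl_class_surj a, cl_class_surj b).
by rewrite -cl_classM !cl_lift_funE.
Qed.

HB.instance Definition _ :=
  GRing.isZmodMorphism.Build Cl T cl_lift_fun cl_lift_fun_zmod.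
HB.instance Definition _ :=
  GRing.isMonoidMorphism.Build Cl T cl_lift_fun cl_lift_fun_monoid.

(** The universal property of the presentation. It supplies the map from C_{p,q} to C_{p+2,q}, the
    matrix representation and the scalar representation showing [1 != 0]. *)
Lemma cl_lift : exists h : {rmorphism Cl -> T},
  (forall k, h (c k) = g k) /\ (forall i, h (e i) = x i).
Proof. by exists cl_lift_fun; split=> [k|i]; exact: cl_lift_funE. Qed.

End Lift.

End CliffordTheory.

(** * Two-by-two matrices over a possibly noncommutative ring *)

Section Matrix2.
Variable B : pzRingType.

Definition mx2 (a b c d : B) : 'M[B]_2 :=
  \matrix_(i, j) if i == 0 then if j == 0 then a else b
                 else if j == 0 then c else d.

Lemma mx2D a b c d a' b' c' d' :
  mx2 a b c d + mx2 a' b' c' d' = mx2 (a + a') (b + b') (c + c') (d + d').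
Proof. by apply/matrixP => i j; rewrite !mxE; do 2!case: ifP. Qed.

Lemma mx2M a b c d a' b' c' d' :
  mx2 a b c d * mx2 a' b' c' d' =
  mx2 (a * a' + b * c') (a * b' + b * d') (c * a' + d * c') (c * b' + d * d').
Proof.
apply/matrixP => i j; rewrite !mxE !big_ord_recl big_ord0 addr0 !mxE /=.
by do 2!case: ifP.
Qed.

Lemma scalar_mx2 a : a%:M = mx2 a 0 0 a.
Proof. by apply/matrixP => -[[|[|]]] // ? [[|[|]]] // ?; rewrite !mxE. Qed.

Lemma mx2_1 : 1 = mx2 1 0 0 1.
Proof. by rewrite -scalar_mx2. Qed.

Lemma mx2_0 : mx2 0 0 0 0 = 0.
Proof. by apply/matrixP => i j; rewrite !mxE; do 2!case: ifP. Qed.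

Lemma mx2_00 a b c d : mx2 a b c d 0 0 = a.
Proof. by rewrite mxE. Qed.

Lemma mx2E (X : 'M[B]_2) : X = mx2 (X 0 0) (X 0 1) (X 1 0) (X 1 1).
Proof.
by apply/matrixP => -[[|[|]]] // ? [[|[|]]] // ?; rewrite mxE /=;
  congr (X _ _); apply: val_inj.
Qed.

End Matrix2.

(** * Removing two non-degenerate generators *)

Section CliffordStep.
Variables (K : numFieldType) (iota : K).
Hypothesis iota2 : iota * iota = -1.
Variables (p q : nat).
Local Notation A := (clifford K p.+2 q).
Local Notation B := (clifford K p q).
Local Notation cA := (@cl_in K p.+2 q).
Local Notation cB := (@cl_in K p q).
Local Notation n := (p + q)%N.

(** [p.+2 + q] is convertible to [2 + n]: the additional generators come first, and shifting the old
    indices by 2 respects the bound between non-degenerate and degenerate ones. *)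
Definition new_gen (i : 'I_2) : A := @cl_gen K p.+2 q (lshift n i).
Definition old_gen (i : 'I_n) : A := @cl_gen K p.+2 q (rshift 2 i).
Local Notation u := (new_gen 0).
Local Notation v := (new_gen 1).
Local Notation e := old_gen.

Definition cl_vol : A := cA iota * u * v.
Definition cl_idem : A := cA 2^-1 * (1 + cl_vol).
Local Notation w := cl_vol.
Local Notation h := (cA 2^-1).
Local Notation f := cl_idem.

Lemma cl_in_centralr k (a : A) : a * cA k = cA k * a.
Proof. by rewrite cl_in_central. Qed.

Lemma new_gen_odd i : sa_comp true (new_gen i).
Proof. exact: cl_comp_gen. Qed.

Lemma new_gen0_sqr : u * u = 1.
Proof. exact: cl_gen_sqr1. Qed.

Lemma new_gen1_sqr : v * v = 1.
Proof. exact: cl_gen_sqr1. Qed.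

Lemma new_gen10 : v * u = - (u * v).
Proof. exact: cl_gen_anticomm. Qed.

Lemma old_newN i j : e i * new_gen j = - (new_gen j * e i).
Proof.
apply: cl_gen_anticomm; apply/eqP => /(congr1 val) /= eij.
by have := ltn_ord j; rewrite -eij.
Qed.

Lemma new_gen0_vol : u * w = cA iota * v.
Proof.
by rewrite /w !mulrA cl_in_centralr -(mulrA _ u u) new_gen0_sqr mulr1.
Qed.

Lemma vol_new_gen0 : w * u = - (cA iota * v).
Proof.
by rewrite /w -!mulrA new_gen10 !mulrN !(mulrA u) new_gen0_sqr mul1r.
Qed.

(** Allows [v] to be replaced by [u] and [w] as a generator, so that it needs no block computation
    of its own. *)
Lemma new_gen1E : v = - cA iota * (u * w).
Proof.
by rewrite new_gen0_vol mulrA mulNr -rmorphM iota2 rmorphN1 opprK mul1r.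
Qed.

Lemma cl_vol_sqr : w * w = 1.
Proof.
rewrite {2}/w !mulrA (cl_in_centralr iota w) -(mulrA _ w) vol_new_gen0 mulrN
  mulNr -!mulrA new_gen1_sqr.
by rewrite mulr1 -rmorphM iota2 rmorphN1 opprK.
Qed.

Lemma new_gen0_volN : u * w = - (w * u).
Proof. by rewrite new_gen0_vol vol_new_gen0 opprK. Qed.

Lemma cl_half2 : h + h = 1.
Proof.
  by rewrite -rmorphD -(mul1r 2^-1) -splitr rmorph1.
Qed.

Lemma cl_idem_sqr : f * f = f.
Proof.
have sq : (1 + w) * (1 + w) = (1 + w) + (1 + w).
  by rewrite mulrDl mul1r mulrDr cl_vol_sqr mulr1 [w + 1]addrC.
rewrite {1}/f -mulrA; congr (_ * _).
by rewrite /f mulrA cl_in_centralr -mulrA sq mulrDr -mulrDl cl_half2 mul1r.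
Qed.

Lemma cl_idem_conj : u * f * u = 1 - f.
Proof.
have uwu : u * (1 + w) * u = 1 - w.
  by rewrite mulrDr mulr1 mulrDl new_gen0_sqr new_gen0_volN mulNr -mulrA
    new_gen0_sqr mulr1.
apply/eqP; rewrite eq_sym subr_eq /f mulrA cl_in_centralr -!mulrA (mulrA u) uwu.
by rewrite -mulrDr addrACA addNr addr0 mulrDr mulr1 cl_half2.
Qed.

Lemma cl_idem_mul_u0 : f * u * f = 0.
Proof.
have -> : f * u * f = f * (u * f * u) * u by rewrite -!mulrA new_gen0_sqr mulr1.
by rewrite cl_idem_conj mulrBr mulr1 cl_idem_sqr subrr mul0r.
Qed.

Lemma cl_idem_even : sa_comp false f.
Proof.
apply: sa_compZ; apply: (grA (sa_grading A)); first exact: sa_comp1.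
rewrite /w -mulrA; apply: sa_compZ.
by apply: (sa_compM (i := true) (j := true)); apply: new_gen_odd.
Qed.

(** Passing [u] and then [v] costs two signs, which cancel. *)
Lemma old_new_comm i : e i * w = w * e i.
Proof.
rewrite /w !mulrA cl_in_centralr -!mulrA; congr (_ * _).
by rewrite mulrA old_newN mulNr -mulrA old_newN mulrN opprK.
Qed.

Lemma ex_cl_shift : exists phi : {rmorphism B -> A},
  (forall k, phi (cB k) = cA k) /\ (forall i, phi (cl_gen K i) = e i).
Proof.
apply: cl_lift => [k a|i j hij|i hi|i hi].
- exact: cl_in_central.
- by rewrite cl_gen_anticomm ?addNr.
- exact: cl_gen_sqr1.
- exact: cl_gen_sqr0.
Qed.

Section Corner.
Variable phi : {rmorphism B -> A}.
Hypotheses (phi_in : forall k, phi (cB k) = cA k)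
  (phi_gen : forall i, phi (cl_gen K i) = e i).

Lemma cl_idem_comm (b : B) : phi b * f = f * phi b.
Proof.
suff wb : phi b * w = w * phi b.
  by rewrite /f mulrA cl_in_centralr -!mulrA mulrDr wb mulr1 mulrDl mul1r.
elim/cl_quot_ind: b => [k|i|a b ha hb|a b ha hb].
- by rewrite phi_in cl_in_central.
- by rewrite phi_gen old_new_comm.
- by rewrite rmorphD mulrDl ha hb mulrDr.
- by rewrite rmorphM -mulrA hb mulrA ha mulrA.
Qed.

Lemma cl_shift_comp i b : sa_comp i b -> sa_comp i (phi b).
Proof.
case=> s [hs ->]; exists [seq (m.1, [seq (rshift 2 j : 'I_(p.+2 + q)) | j <-
  m.2]) | m <- s].
split; first by rewrite all_map; apply: sub_all hs => m /=; rewrite size_map.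
rewrite rmorph_sum big_map; apply: eq_bigr => m _ /=.
rewrite rmorphM phi_in rmorph_prod big_map; congr (_ * _).
by apply: eq_bigr => j _; rewrite phi_gen.
Qed.

(* This matrix representation sends [cl_corner b] to the matrix with the single
   entry [b], whence the injectivity of [cl_corner]. *)
Lemma ex_cl_matrix : exists Phi : {rmorphism A -> 'M[B]_2},
  [/\ forall k, Phi (cA k) = (cB k)%:M,
      Phi u = mx2 0 1 1 0,
      Phi v = mx2 0 (cB iota) (- cB iota) 0
    & forall i, Phi (e i) = mx2 (cl_gen K i) 0 0 (- cl_gen K i)].
Proof.
pose g := (@scalar_mx B 2) \o cB.
(* These are the blocks for [1 = f + u f u]: [u] swaps the summands, [u e_i u = - e_i] explains the
   sign on old generators, and the entries for [v] are those that send [w] to the diagonal matrix 1,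
   -1, hence [f] to 1, 0. *)
pose x (i : 'I_(2 + n)) := match split i with
  | inl j => if j == 0 then mx2 0 1 1 0 else mx2 0 (cB iota) (- cB iota) 0
  | inr j => mx2 (cl_gen K j) 0 0 (- cl_gen K j) end.
have g_central k (a : 'M[B]_2) : g k * a = a * g k.
  rewrite [a]mx2E /g /= scalar_mx2 !mx2M !mul0r !mulr0 !addr0 !add0r.
  by congr mx2; apply: cl_in_central.
have xl j : x (lshift n j) =
    if j == 0 then mx2 0 1 1 0 else mx2 0 (cB iota) (- cB iota) 0.
  by rewrite /x (unsplitK (inl j)).
have xr j : x (rshift 2 j) = mx2 (cl_gen K j) 0 0 (- cl_gen K j).
  by rewrite /x (unsplitK (inr j)).
have simp := (mul0r, mulr0, addr0, add0r, mul1r, mulr1, mulrN, mulNr, @opprK B).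
have x_lr i j : x (lshift n i) * x (rshift 2 j) = - (x (rshift 2 j) * x (lshift
  n i)).
  rewrite xl xr; apply/eqP; rewrite -addr_eq0; apply/eqP.
  case: ifP => _; rewrite !mx2M mx2D !simp ?addNr ?addrN ?mx2_0 //.
  by rewrite cl_in_central addNr mx2_0.
have x_anticomm (i j : 'I_(2 + n)) : i != j -> x i * x j + x j * x i = 0.
  case: (split_ordP i) => a ->; case: (split_ordP j) => b ->.
  - rewrite !xl (inj_eq (@lshift_inj _ _)).
    case: a b => -[|[|]] // ? [[|[|]]] // ? _.
      by rewrite !mx2M mx2D !simp addrN addNr mx2_0.
    by rewrite !mx2M mx2D !simp addrN addNr mx2_0.
  - by rewrite x_lr addNr.
  - by rewrite x_lr addrN.
  - rewrite !xr (inj_eq (@rshift_inj _ _)) => hab.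
    by rewrite !mx2M mx2D !simp (cl_gen_anticomm _ hab) addNr mx2_0.
have x_sqr1 (i : 'I_(2 + n)) : (i < p.+2)%N -> x i * x i = 1.
  case: (split_ordP i) => a -> hi.
    rewrite xl mx2_1; case: ifP => _; rewrite mx2M !simp // -rmorphM iota2.
    by rewrite rmorphN1 opprK.
  by rewrite xr mx2_1 mx2M !simp cl_gen_sqr1.
have x_sqr0 (i : 'I_(2 + n)) : (p.+2 <= i)%N -> x i * x i = 0.
  case: (split_ordP i) => a -> hi.
    by have := leq_trans hi (ltn_ord a).
  by rewrite xr mx2M !simp cl_gen_sqr0 // mx2_0.
have [Phi [Phi_in Phi_gen]] :=
  @cl_lift K p.+2 q 'M[B]_2 g x g_central x_anticomm x_sqr1 x_sqr0.
by exists Phi; split=> [k||| i]; rewrite /= ?Phi_in ?Phi_gen ?xl ?xr.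
Qed.

Definition cl_corner (b : B) : A := phi b * f.
Local Notation psi := cl_corner.

Lemma cl_cornerD : {morph psi : a b / a + b}.
Proof. by move=> a b; rewrite /psi rmorphD mulrDl. Qed.

Lemma cl_cornerM : {morph psi : a b / a * b}.
Proof.
move=> a b; rewrite /psi rmorphM -(mulrA _ (phi b)) -(mulrA (phi a) f).
by rewrite (mulrA f) -cl_idem_comm -(mulrA _ f) cl_idem_sqr.
Qed.

Lemma cl_corner1 : psi 1 = f.
Proof. by rewrite /psi rmorph1 mul1r. Qed.

Lemma cl_corner_inj : injective psi.
Proof.
have [Phi [Phi_in Phi_u Phi_v Phi_e]] := ex_cl_matrix.
have simp := (mul0r, mulr0, addr0, add0r, mul1r, mulr1, mulrN, mulNr, @opprK B).
(* The lower right entry is [b] with the sign of every generator changed; multiplication by [Phi f]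
   erases it, so it is left unspecified. *)
have Phi_phi b : exists c, Phi (phi b) = mx2 b 0 0 c.
  elim/cl_quot_ind: b => [k|i|a b [a' ha] [b' hb]|a b [a' ha] [b' hb]].
  - by exists (cB k); rewrite phi_in Phi_in scalar_mx2.
  - by exists (- cl_gen K i); rewrite phi_gen Phi_e.
  - by exists (a' + b'); rewrite !rmorphD ha hb mx2D !addr0.
  - by exists (a' * b'); rewrite !rmorphM ha hb mx2M !simp.
have Phi_f : Phi f = mx2 1 0 0 0.
  rewrite /f /w !rmorphM rmorphD rmorph1 !rmorphM !Phi_in Phi_u Phi_v.
  rewrite mx2_1 !scalar_mx2 !mx2M !simp mx2D !simp -!rmorphM iota2.
  have n2 : 2 != 0 :> K by rewrite pnatr_eq0.
  rewrite rmorphN1 opprK addrN mx2M !simp -(rmorph1 cB) -rmorphD -rmorphM.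
  by rewrite (mulVf n2) rmorph1.
move=> a b e_ab.
have {e_ab} : Phi (phi a * f) = Phi (phi b * f) by congr (Phi _).
have [[a' ha] [b' hb]] := (Phi_phi a, Phi_phi b).
rewrite (rmorphM Phi (phi a)) (rmorphM Phi (phi b)) ha hb Phi_f !mx2M !simp =>
  /(congr1 (fun X : 'M_2 => X 0 0)).
by rewrite !mx2_00.
Qed.

Definition in_corner (x : A) : Prop := exists b, x = psi b.

Lemma in_cornerD x y : in_corner x -> in_corner y -> in_corner (x + y).
Proof. by move=> [a ->] [b ->]; exists (a + b); rewrite cl_cornerD. Qed.

Lemma in_cornerM x y : in_corner x -> in_corner y -> in_corner (x * y).
Proof. by move=> [a ->] [b ->]; exists (a * b); rewrite cl_cornerM. Qed.

Lemma in_corner0 : in_corner 0.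
Proof. by exists 0; rewrite /psi rmorph0 mul0r. Qed.

Lemma in_cornerZ k : in_corner (cA k * f).
Proof. by exists (cB k); rewrite /psi phi_in. Qed.

(** The block product rule once more, now inside [A]: the compression to [B] is available only after
    [corner] has been established, which is the aim here. *)
Lemma cl_corner_split (a b : A) :
  f * (a * b) * f = (f * a * f) * (f * b * f) +
    (f * (a * u) * f) * (f * (u * b) * f).
Proof.
have -> : f * a * f * (f * b * f) = f * a * f * b * f.
  by rewrite (mulrA (f * a * f)) (mulrA (f * a * f) f) -(mulrA (f * a) f f)
    cl_idem_sqr.
have -> : f * (a * u) * f * (f * (u * b) * f) = f * a * (u * f * u) * b * f.
  rewrite (mulrA (f * (a * u) * f)) (mulrA (f * (a * u) * f) f).
  by rewrite -(mulrA (f * (a * u)) f f) cl_idem_sqr !mulrA.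
by rewrite cl_idem_conj -!mulrDl -mulrDr addrC subrK mulr1 (mulrA f a).
Qed.

(* The four blocks of [a] for [1 = f + u f u] are studied together because only
   then is the property stable under products. *)
Definition split_in_corner (a : A) : Prop :=
  [/\ in_corner (f * a * f), in_corner (f * (a * u) * f),
      in_corner (f * (u * a) * f) & in_corner (f * (u * a * u) * f)].

Lemma split_in_cornerD a b :
  split_in_corner a -> split_in_corner b -> split_in_corner (a + b).
Proof.
move=> [a1 a2 a3 a4] [b1 b2 b3 b4]; rewrite /split_in_corner.
by split; rewrite !(mulrDr, mulrDl); apply: in_cornerD.
Qed.

Lemma split_in_cornerM a b :
  split_in_corner a -> split_in_corner b -> split_in_corner (a * b).
Proof.
move=> [a1 a2 a3 a4] [b1 b2 b3 b4].
have ins x y : in_corner (f * x * f) -> in_corner (f * (x * u) * f) ->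
    in_corner (f * y * f) -> in_corner (f * (u * y) * f) ->
    in_corner (f * (x * y) * f).
  by move=> *; rewrite cl_corner_split; apply: in_cornerD; apply: in_cornerM.
split; first exact: ins.
- by rewrite -(mulrA a); apply: ins; rewrite ?(mulrA u).
- by rewrite (mulrA u); apply: ins.
- by rewrite (mulrA u) -(mulrA (u * a)); apply: ins; rewrite ?(mulrA u).
Qed.

Lemma split_in_cornerZ k : split_in_corner (cA k).
Proof.
have fk x : f * (cA k * x) * f = cA k * (f * x * f).
  by rewrite (mulrA f) -(cl_in_central k f) -!(mulrA (cA k)).
split.
- rewrite -(mulr1 (cA k)) fk mulr1 cl_idem_sqr; exact: in_cornerZ.
- by rewrite fk cl_idem_mul_u0 mulr0; apply: in_corner0.
- by rewrite -(cl_in_central k u) fk cl_idem_mul_u0 mulr0; apply: in_corner0.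
- rewrite -(cl_in_central k u) -(mulrA _ u) fk new_gen0_sqr mulr1 cl_idem_sqr.
  exact: in_cornerZ.
Qed.

Lemma split_in_corner_u : split_in_corner u.
Proof.
have f1 : in_corner f by have := in_cornerZ 1; rewrite rmorph1 mul1r.
by split; rewrite ?new_gen0_sqr ?mul1r ?mulr1 ?cl_idem_mul_u0 ?cl_idem_sqr //;
  apply: in_corner0.
Qed.

Lemma split_in_corner_f : split_in_corner f.
Proof.
have f1 : in_corner f by have := in_cornerZ 1; rewrite rmorph1 mul1r.
split.
- by rewrite cl_idem_sqr cl_idem_sqr.
- by rewrite (mulrA f) cl_idem_sqr cl_idem_mul_u0; apply: in_corner0.
- by rewrite -(mulrA f) -(mulrA u) cl_idem_sqr (mulrA f) cl_idem_mul_u0;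
    apply: in_corner0.
- by rewrite cl_idem_conj mulrBr mulr1 cl_idem_sqr subrr mul0r;
    apply: in_corner0.
Qed.

(** As [e i] commutes with [f] and anticommutes with [u], its diagonal blocks come from the
    generator and its opposite, and the others are multiples of [f * u * f = 0]. *)
Lemma split_in_corner_e i : split_in_corner (e i).
Proof.
have ef : e i * f = f * e i by rewrite -phi_gen cl_idem_comm.
have eu : u * e i = - (e i * u) by rewrite old_newN opprK.
have fef : f * e i * f = psi (cl_gen K i).
  by rewrite -ef -(mulrA (e i)) cl_idem_sqr /psi phi_gen.
have feu : f * (e i * u) * f = 0.
  by rewrite (mulrA f) -ef -!(mulrA (e i)) cl_idem_mul_u0 mulr0.
split.
- by exists (cl_gen K i).
- by rewrite feu; apply: in_corner0.
- by rewrite eu mulrN mulNr feu oppr0; apply: in_corner0.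
- rewrite eu mulNr -(mulrA (e i)) new_gen0_sqr mulr1 mulrN mulNr fef.
  by exists (- cl_gen K i); rewrite /psi rmorphN mulNr.
Qed.

Lemma split_in_cornerP a : split_in_corner a.
Proof.
(* With [v] a scalar multiple of [u * w] and [w = 2 f - 1], scalars, [u], [f] and the old generators
   suffice to generate [A]. *)
have wE : w = cA 2 * f + cA (-1).
  have n2 : 2 != 0 :> K by rewrite pnatr_eq0.
  by rewrite /f (mulrA (cA 2)) -rmorphM (mulfV n2) rmorph1 mul1r rmorphN1 addrAC
    subrr add0r.
elim/cl_quot_ind: a => [k|i|a b|a b].
- exact: split_in_cornerZ.
- case: (@split_ordP 2 n i) => j ->; last exact: split_in_corner_e.
  have [->|->] : j = 0 \/ j = 1.
    by case: j => -[|[|]] // ?; [left|right]; apply: val_inj.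
    exact: split_in_corner_u.
  have -> : @cl_gen K p.+2 q (lshift n (1 : 'I_2)) = cA (- iota) * (u * w).
    by rewrite rmorphN -new_gen1E.
  apply: split_in_cornerM; first exact: split_in_cornerZ.
  apply: split_in_cornerM; first exact: split_in_corner_u.
  rewrite wE; apply: split_in_cornerD; last exact: split_in_cornerZ.
  apply: split_in_cornerM; first exact: split_in_cornerZ.
  exact: split_in_corner_f.
- exact: split_in_cornerD.
- exact: split_in_cornerM.
Qed.

Lemma cl_cornerP : corner (psi : B -> A).
Proof.
split.
- exact: cl_cornerD.
- exact: cl_cornerM.
- by move=> k; rewrite cl_corner1 /= /psi phi_in.
- move=> i b hb; rewrite -(addbF i).
  exact: sa_compM (cl_shift_comp hb) cl_idem_even.
- exact: cl_corner_inj.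
- by move=> a; rewrite cl_corner1; have [] := split_in_cornerP a.
Qed.

End Corner.

Lemma clifford_step : exists psi : B -> A,
  corner psi /\ equivalent_categories (Gr A) (Gr B).
Proof.
have [phi [phi_in phi_gen]] := ex_cl_shift.
exists (cl_corner phi); split; first exact: cl_cornerP.
apply: (corner_equivalence (cl_cornerP phi_in phi_gen) (new_gen_odd 0)
  new_gen0_sqr).
by rewrite cl_corner1 cl_idem_conj.
Qed.

End CliffordStep.

(** * Finite dimension *)

Section Span.
Variables (K : fieldType) (A : superalgebra K).
Implicit Types s t : seq A.

(** Coefficients are indexed by [nat] so that concatenating lists needs no transport between ordinal
    types. *)
Definition spanned s (a : A) : Prop :=
  exists c : nat -> K, a = \sum_(i < size s) sa_in A (c i) * s`_i.

Lemma spanned0 s : spanned s 0.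
Proof.
by exists (fun=> 0); rewrite big1 // => i _; rewrite rmorph0 mul0r.
Qed.

Lemma spannedD s a b : spanned s a -> spanned s b -> spanned s (a + b).
Proof.
move=> [c ->] [d ->]; exists (fun i => c i + d i); rewrite -big_split.
by apply: eq_bigr => i _; rewrite rmorphD mulrDl.
Qed.

Lemma spannedZ s k a : spanned s a -> spanned s (sa_in A k * a).
Proof.
move=> [c ->]; exists (fun i => k * c i); rewrite mulr_sumr.
by apply: eq_bigr => i _; rewrite mulrA -rmorphM.
Qed.

Lemma spanned_cat s t a : spanned (s ++ t) a <->
  exists b b', [/\ spanned s b, spanned t b' & a = b + b'].
Proof.
split.
  move=> [c ->]; rewrite size_cat big_split_ord /=.
  exists (\sum_(i < size s) sa_in A (c i) * s`_i).
  exists (\sum_(i < size t) sa_in A (c (size s + i)%N) * t`_i).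
  split; [by exists c|by exists (fun i => c (size s + i)%N)|congr (_ + _)].
    by apply: eq_bigr => i _; rewrite nth_cat ltn_ord.
  by apply: eq_bigr => i _; rewrite nth_cat ltnNge leq_addr addKn.
move=> [_ [_ [[c ->] [d ->] ->]]].
exists (fun i => if (i < size s)%N then c i else d (i - size s)%N).
rewrite size_cat big_split_ord /=; congr (_ + _).
  by apply: eq_bigr => i _; rewrite nth_cat ltn_ord.
by apply: eq_bigr => i _; rewrite nth_cat ltnNge leq_addr addKn.
Qed.

Lemma spanned_mulr s (x : A) a : spanned [seq y * x | y <- s] a <->
  exists2 b, spanned s b & a = b * x.
Proof.
split.
  move=> [c ->]; rewrite size_map.
  exists (\sum_(i < size s) sa_in A (c i) * s`_i); first by exists c.
  rewrite mulr_suml; apply: eq_bigr => i _.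
  by rewrite (nth_map 0) ?mulrA.
move=> [_ [c ->] ->]; exists c; rewrite size_map mulr_suml.
by apply: eq_bigr => i _; rewrite (nth_map 0) ?mulrA.
Qed.

Lemma spanned_finite_dimensional s :
  (forall a : A, spanned s a) -> finite_dimensional A.
Proof.
by move=> h; exists s => a; have [c ->] := h a; exists (fun i => c i).
Qed.

End Span.

Section CliffordSpan.
Variables (K : numFieldType) (p q : nat).
Local Notation Cl := (clifford K p q).
Local Notation e := (@cl_gen K p q).

Lemma cl_gen_sqr i : exists r, e i * e i = cl_in p q r.
Proof.
case: (ltnP i p) => hi; first by exists 1; rewrite cl_gen_sqr1.
by exists 0; rewrite cl_gen_sqr0 // rmorph0.
Qed.

(* [s] spans the subalgebra generated by the first [k] generators; the other
   generators normalise it. *)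
Definition spans_subalgebra (s : seq Cl) (k : nat) : Prop :=
  [/\ spanned s 1,
      forall a b, spanned s a -> spanned s b -> spanned s (a * b),
      forall i : 'I_(p + q), (i < k)%N -> spanned s (e i)
    & forall (i : 'I_(p + q)) a, (k <= i)%N -> spanned s a ->
        exists2 a', spanned s a' & e i * a = a' * e i].

(** Adjoining the next generator [x] doubles the list, from S to S + S x. This is closed under
    products because [x] can be moved to the right past S and [x * x] is a scalar. *)
Lemma ex_spans_subalgebra k : (k <= p + q)%N -> exists s, spans_subalgebra s k.
Proof.
elim: k => [_|k IH hk].
  have sp1 (a : Cl) : spanned [:: 1 : Cl] a <-> exists r, a = cl_in p q r.
    split=> [[c ->]|[r ->]]; last by exists (fun=> r); rewrite big_ord1 mulr1.
    by exists (c 0); rewrite big_ord1 mulr1.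
  exists [:: 1]; split=> //.
  - by apply/sp1; exists 1; rewrite rmorph1.
  - by move=> a b /sp1[r ->] /sp1[t ->]; apply/sp1; exists (r * t);
      rewrite rmorphM.
  - move=> i a _ /sp1[r ->]; exists (cl_in p q r); first by apply/sp1; exists r.
    by rewrite cl_in_central.
have [s [s1 sM se sC]] := IH (ltnW hk).
pose x : Cl := e (Ordinal hk).
have [r xx] := cl_gen_sqr (Ordinal hk).
have S a : spanned (s ++ [seq y * x | y <- s]) a <->
    exists b b', [/\ spanned s b, spanned s b' & a = b + b' * x].
  split.
    by case/spanned_cat => b [_ [hb /spanned_mulr[b' hb' ->] ->]]; exists b, b'.
  case=> b [b' [hb hb' ->]]; apply/spanned_cat; exists b, (b' * x); split=> //.
  by apply/spanned_mulr; exists b'.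
have s0 := spanned0 s.
exists (s ++ [seq y * x | y <- s]); split.
- by apply/S; exists 1, 0; rewrite mul0r addr0.
- move=> _ _ /S[a [a' [ha ha' ->]]] /S[b [b' [hb hb' ->]]]; apply/S.
  have [c hc ec] := sC (Ordinal hk) b (leqnn k) hb.
  have [c' hc' ec'] := sC (Ordinal hk) b' (leqnn k) hb'.
  (* Expansion of [(a + a' * x) * (b + b' * x)] with [x * b = c * x], [x * b' = c' * x] and
     [x * x = r]. *)
  exists (a * b + cl_in p q r * (a' * c')), (a * b' + a' * c); split.
  + by apply: spannedD; [exact: sM|apply/spannedZ/sM].
  + by apply: spannedD; exact: sM.
  have e1 : a' * x * b = a' * c * x by rewrite -mulrA ec mulrA.
  have e2 : a' * x * (b' * x) = cl_in p q r * (a' * c').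
    rewrite -(mulrA a') (mulrA x) ec' -(mulrA c') xx -(cl_in_central r c').
    by rewrite mulrA -(cl_in_central r a') -mulrA.
  rewrite mulrDl !mulrDr e1 e2 mulrDl (mulrA a b') -!addrA; congr (_ + _).
  by rewrite addrA addrC.
- move=> i; rewrite ltnS leq_eqVlt => /orP[/eqP ik|ik]; apply/S.
    exists 0, 1; split=> //; rewrite add0r mul1r /x; congr (e _).
    exact: val_inj.
  by exists (e i), 0; rewrite mul0r addr0; split=> //; apply: se.
- move=> i _ ki /S[a [a' [ha ha' ->]]].
  have [b hb eb] := sC i a (ltnW ki) ha.
  have [b' hb' eb'] := sC i a' (ltnW ki) ha'.
  (* The sign comes from moving [e i] past [x]. *)
  exists (b - b' * x).
    apply/S; exists b, (cl_in p q (-1) * b'); split=> //; first exact: spannedZ.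
    by rewrite rmorphN1 mulN1r mulNr.
  have ix : e i * x = - (x * e i).
    by apply: cl_gen_anticomm; rewrite -val_eqE /= gtn_eqF.
  by rewrite mulrDr eb mulrA eb' -mulrA ix mulrN mulrA mulrBl.
Qed.

Lemma clifford_finite_dimensional : finite_dimensional Cl.
Proof.
have [s [s1 sM se _]] := ex_spans_subalgebra (leqnn (p + q)).
apply: (@spanned_finite_dimensional _ _ s) => a.
elim/cl_quot_ind: a => [k|i|a b|a b].
- by rewrite -(mulr1 (cl_in _ _ k)); apply: spannedZ.
- by apply: se.
- exact: spannedD.
- exact: sM.
Qed.

End CliffordSpan.

(** * Primitivity of the unit *)

Lemma exprn_idempotent (T : pzRingType) (f : T) k : f * f = f ->
  f ^+ k.+1 = f.
Proof. by move=> ff; elim: k => // k IH; rewrite exprS IH. Qed.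

Section Primitive1.
Variables (K : fieldType) (A : superalgebra K).

(* If [f - k] is nilpotent for an idempotent [f], then evaluating its power on
   [f] and on [1 - f] shows that [f = 0] when [k = 0] and [f = 1] otherwise. *)
Lemma idempotent_scalar_nilpotent (f : A) k N : f * f = f ->
  (f - sa_in A k) ^+ N = 0 -> f = 0 \/ f = 1.
Proof.
move=> ff nil.
have [k0|k_neq0] := eqVneq k 0; [left|right].
  move: nil; rewrite k0 rmorph0 subr0; case: N => [|N].
    by rewrite expr0 => e; rewrite -(mulr1 f) e mulr0.
  by rewrite exprn_idempotent.
have gf : (1 - f) * f = 0 by rewrite mulrBl mul1r ff subrr.
have pow m : (1 - f) * (f - sa_in A k) ^+ m = sa_in A ((- k) ^+ m) * (1 - f).
  elim: m => [|m IH]; first by rewrite !expr0 rmorph1 mulr1 mul1r.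
  rewrite exprSr mulrA IH -mulrA mulrBr gf sub0r -sa_central -mulNr -rmorphN.
  by rewrite mulrA -rmorphM -exprSr.
have := pow N; rewrite nil mulr0 => e0.
have : sa_in A ((- k) ^- N) * (sa_in A ((- k) ^+ N) * (1 - f)) = 0.
  by rewrite -e0 mulr0.
rewrite mulrA -rmorphM mulVf ?expf_neq0 ?oppr_eq0 // rmorph1 mul1r.
by move/eqP; rewrite subr_eq0 => /eqP.
Qed.

(** Once 1 is primitive it forms a complete set by itself, and the condition on pairs of distinct
    idempotents is vacuous for either shift. *)
Lemma local_graded_basic S : (1 : A) != 0 ->
  (forall f : A, sa_comp false f -> exists k N, (f - sa_in A k) ^+ N = 0) ->
  S_graded_basic A S.
Proof.
move=> one0 nil.
have prim1 : primitive (1 : A).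
  split=> //; first by split; [exact: sa_comp1|exact: mul1r].
  move=> g h [g_even gg] _ gh0 _ e1.
  have [k [N nilg]] := nil g g_even.
  have [->|g1] := idempotent_scalar_nilpotent gg nilg; first by left.
  by right; rewrite -(mul1r h) -{1}g1.
exists 1%N, (fun=> 1).
have cps : complete_primitive_set (fun _ : 'I_1 => 1 : A).
  by split=> [_|//|i j|]; rewrite ?big_ord1 ?(ord1 i) ?(ord1 j) //;
     exact: sa_comp1.
by exists cps => i j; rewrite (ord1 i) (ord1 j).
Qed.

End Primitive1.

(** * Nilpotency of the ideal of degenerate generators *)

Section CliffordNilpotent.
Variables (K : numFieldType) (p q : nat).
Local Notation Cl := (clifford K p q).
Local Notation e := (@cl_gen K p q).
Local Notation c := (@cl_in K p q).
Local Notation word := (seq 'I_(p + q)).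

Definition cl_word (w : word) : Cl := \prod_(i <- w) e i.

Lemma cl_word_cons i w : cl_word (i :: w) = e i * cl_word w.
Proof. by rewrite /cl_word big_cons. Qed.

Lemma cl_word_cat w w' : cl_word (w ++ w') = cl_word w * cl_word w'.
Proof. by rewrite /cl_word big_cat. Qed.

Lemma mulr_signCA (s : bool) (x y : Cl) :
  x * ((-1) ^+ s * y) = (-1) ^+ s * (x * y).
Proof. by case: s; rewrite ?expr1 ?mulN1r ?mulrN // expr0 !mul1r. Qed.

(** The sign depends on how often [i] itself occurs in [w]; only its existence matters, since the
    word is about to be multiplied by [e i], whose square may be 0. *)
Lemma cl_gen_word i w : exists s : bool,
  e i * cl_word w = (-1) ^+ s * (cl_word w * e i).
Proof.
elim: w => [|j w [s IH]].
  by exists false; rewrite /cl_word big_nil expr0 !mul1r mulr1.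
rewrite cl_word_cons; have [<-|ij] := eqVneq i j.
  by exists s; rewrite {1}IH mulr_signCA mulrA.
exists (~~ s); rewrite mulrA (cl_gen_anticomm K ij) mulNr -mulrA IH mulr_signCA.
by rewrite mulrA signrN mulNr.
Qed.

(* A repeated degenerate generator can be moved next to its first occurrence,
   up to sign. *)
Lemma cl_word_repeat (i : 'I_(p + q)) w1 w2 w3 : (p <= i)%N ->
  cl_word (w1 ++ i :: w2 ++ i :: w3) = 0.
Proof.
move=> hi; rewrite cl_word_cat cl_word_cons cl_word_cat cl_word_cons.
have iwi : e i * cl_word w2 * e i = 0.
  have [s ->] := cl_gen_word i w2.
  by rewrite -!mulrA cl_gen_sqr0 // !mulr0.
by rewrite (mulrA (e i)) (mulrA _ (e i)) iwi mul0r mulr0.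
Qed.

Definition degenerate_count (w : word) : nat := count (fun i : 'I_(p + q) => p
  <= i)%N w.

(** Pigeonhole: there are only [q] degenerate generators, so one of them is repeated. *)
Lemma cl_word_nilpotent w : (q < degenerate_count w)%N -> cl_word w = 0.
Proof.
move=> hw; have : ~~ uniq [seq i : 'I_(p + q) <- w | (p <= i)%N].
  apply: contraL hw => uw; rewrite -leqNgt /degenerate_count -size_filter.
  rewrite -[leqRHS]card_ord -(size_codom (@rshift p q)).
  apply: uniq_leq_size => // i; rewrite mem_filter => /andP[hi _].
  case: (split_ordP i) hi => j -> /=; last by rewrite codom_f.
  by rewrite leqNgt ltn_ord.
elim: w {hw} => // i w IH /=; case: ifP => hi /=; last first.
  by move/IH; rewrite cl_word_cons => ->; rewrite mulr0.
rewrite negb_and negbK => /orP[|/IH]; last first.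
  by rewrite cl_word_cons => ->; rewrite mulr0.
rewrite mem_filter => /andP[_ /splitPr[w1 w2]].
exact: (@cl_word_repeat i [::]).
Qed.

(** The [k]-th power of the two-sided ideal generated by the degenerate generators, presented by
    spanning words so that products are handled by induction on both factors. *)
Inductive degenerate_ideal (k : nat) : Cl -> Prop :=
  | Deg0 : degenerate_ideal k 0
  | DegWord r w of (k <= degenerate_count w)%N :
      degenerate_ideal k (c r * cl_word w)
  | DegAdd x y of degenerate_ideal k x & degenerate_ideal k y :
      degenerate_ideal k (x + y).

Lemma degenerate_idealM k l x y : degenerate_ideal k x ->
  degenerate_ideal l y -> degenerate_ideal (k + l) (x * y).
Proof.
move=> hx hy; elim: hx => {x} [|r w hw|x x' _ IH _ IH'].
- by rewrite mul0r; apply: Deg0.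
- elim: hy => {y} [|t w' hw'|y y' _ IH _ IH'].
  + by rewrite mulr0; apply: Deg0.
  + have -> : c r * cl_word w * (c t * cl_word w') = c (r * t) * cl_word (w ++
      w').
      by rewrite cl_word_cat rmorphM -!mulrA (mulrA (cl_word w)) -cl_in_central
        -mulrA.
    by apply: DegWord; rewrite /degenerate_count count_cat leq_add.
  + by rewrite mulrDr; apply: DegAdd.
- by rewrite mulrDl; apply: DegAdd.
Qed.

Lemma degenerate_ideal_eq0 k x : (q < k)%N -> degenerate_ideal k x -> x = 0.
Proof.
move=> hk; elim=> {x} [//|r w hw|x y _ -> _ ->]; last by rewrite addr0.
by rewrite cl_word_nilpotent ?mulr0 //; apply: leq_trans hk hw.
Qed.

Lemma degenerate_idealX x k : degenerate_ideal 1 x ->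
  degenerate_ideal k (x ^+ k).
Proof.
move=> hx; elim: k => [|k IH]; last by rewrite exprS;
  exact: (degenerate_idealM hx IH).
rewrite expr0; have := @DegWord 0 1 [::] (leqnn 0).
by rewrite /cl_word big_nil rmorph1 mulr1.
Qed.

Hypothesis p_le1 : (p <= 1)%N.

Lemma nondegenerate_eq (i j : 'I_(p + q)) : (i < p)%N -> (j < p)%N -> i = j.
Proof.
move=> hi hj; apply: val_inj => /=.
have := leq_trans hi p_le1; have := leq_trans hj p_le1.
by case: (i : nat) (j : nat) => [|?] [|?].
Qed.

(** With [p <= 1] all letters of such a word are the same involution. For larger [p] a product of
    two different generators would be even and not scalar. *)
Lemma nondegenerate_word w : degenerate_count w = 0%N ->
  if odd (size w) then exists2 i : 'I_(p + q), (i < p)%N & cl_word w = e i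
  else cl_word w = 1.
Proof.
elim: w => [_|i w IH]; first by rewrite /cl_word big_nil.
rewrite /degenerate_count /= -/(degenerate_count w) cl_word_cons.
case: leqP => // hi /IH; case: (odd (size w)) => /= [[j hj ->]|->].
  by rewrite (nondegenerate_eq hj hi) cl_gen_sqr1.
by exists i; rewrite ?mulr1.
Qed.

Lemma clifford_even_local (x : Cl) : sa_comp false x ->
  exists k, degenerate_ideal 1 (x - c k).
Proof.
case=> s [+ ->]; elim: s => [_|[r w] s IH /= /andP[/eqP hw /IH[k hk]]].
  by exists 0; rewrite big_nil rmorph0 subr0; apply: Deg0.
rewrite big_cons -/(cl_word w).
have [w0|w_gt0] := posnP (degenerate_count w).
  have := nondegenerate_word w0; rewrite hw => ->.
  (* An even word without degenerate letters equals 1, so the scalar part collects the coefficients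
     of these words. *)
  by exists (r + k); rewrite mulr1 rmorphD opprD addrACA subrr add0r.
exists k; rewrite -addrA; apply: DegAdd => //.
exact: DegWord.
Qed.

(** A representation on scalars: non-degenerate generators go to 1, degenerate ones to 0.
    Anticommutation survives in the commutative field because at most one generator has a nonzero
    image. *)
Lemma clifford_neq0 : (1 : Cl) != 0.
Proof.
pose x (i : 'I_(p + q)) : K := (i < p)%N%:R.
have x_anticomm i j : i != j -> x i * x j + x j * x i = 0.
  rewrite /x => ij.
  case: (ltnP i p) => hi; case: (ltnP j p) => hj;
    rewrite ?(mulr0, mul0r, addr0) //.
  by rewrite (nondegenerate_eq hi hj) eqxx in ij.
have [i hi|i hi|h _] := @cl_lift K p q K idfun x (fun _ => mulrC _) x_anticomm.
- by rewrite /x hi mulr1.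
- by rewrite /x ltnNge hi mulr0.
apply/eqP => /(congr1 h); rewrite rmorph1 rmorph0 => /eqP.
by rewrite oner_eq0.
Qed.

Lemma clifford_graded_basic : graded_basic Cl.
Proof.
left; apply: local_graded_basic; first exact: clifford_neq0.
move=> f /clifford_even_local[k hk]; exists k, q.+1.
exact: (degenerate_ideal_eq0 (ltnSn q) (degenerate_idealX _ hk)).
Qed.

End CliffordNilpotent.

(** The shape [m * 2 + r] is that of Euclidean division, and its value at [m.+1] reduces to a double
    successor, so the step applies without casts. *)
Lemma clifford_corner (K : numFieldType) (iota : K) (m r q : nat) :
  iota * iota = -1 ->
  exists psi : clifford K r q -> clifford K (m * 2 + r) q, corner psi /\
    equivalent_categories (Gr (clifford K (m * 2 + r) q)) (Gr (clifford K r q)).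
Proof.
move=> iota2; elim: m => [|m [psi [psiP eqv]]].
  exists (fun a => a); split; first exact: corner_id.
  exact: equivalent_categories_refl.
have [psi' [psiP' eqv']] := clifford_step iota2 (m * 2 + r) q.
exists (psi' \o psi); split; first exact: corner_trans.
exact: equivalent_categories_trans eqv' eqv.
Qed.

Theorem theorem4p12 (R : realType) (p q : nat) :
  graded_morita_equivalent (clifford R[i] p q) (clifford R[i] (p %% 2)%N q) /\
  graded_basic (clifford R[i] (p %% 2)%N q).
Proof.
split; last by apply: clifford_graded_basic; rewrite -ltnS ltn_mod.
have iota2 : 'i * 'i = -1 :> R[i] by rewrite -expr2 sqrCi.
have [psi [psiP eqv]] := clifford_corner (p %/ 2) (p %% 2) q iota2.
rewrite -divn_eq in psi psiP eqv.
split=> //; [exact: clifford_finite_dimensional..|].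
exact: corner_proj_End psiP.
Qed.
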